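(* Let $M_t=\mathbb{E}[X_n\mid X_0,\dots,X_{m(t)},I_t^{(n)}]$ be an $n$-arc filtered arcade martingale restricted to $t\in(T_0,T_n)_*$. Then $$M_t=\frac{\int_{\mathbb{R}}y\,f^{I_t^{(n)}\mid X_0,\dots,X_{m(t)},X_n=y}(I_t^{(n)})\,\mathrm dF^{X_n\mid X_0,\dots,X_{m(t)}}(y)}{\int_{\mathbb{R}}f^{I_t^{(n)}\mid X_0,\dots,X_{m(t)},X_n=y}(I_t^{(n)})\,\mathrm dF^{X_n\mid X_0,\dots,X_{m(t)}}(y)},$$ where $F^{X_n\mid X_0,\dots,X_{m(t)}}$ is the distribution function of $X_n$ conditional on the random vector $(X_0,\dots,X_{m(t)})$ and $f^{I_t^{(n)}\mid X_0,\dots,X_{m(t)},X_n=y}$ is the conditional density of $I_t^{(n)}$ given $X_0,\dots,X_{m(t)}$ and $X_n=y$. In particular: 1. If $(X_0,\dots,X_{m(t)},X_n)$ is a continuous random vector, with conditional density function $f^{X_n\mid X_0,\dots,X_{m(t)}}$, then $$M_t=\frac{\int_{\mathbb{R}}y\,f^{I_t^{(n)}\mid X_0,\dots,X_{m(t)},X_n=y}(I_t^{(n)})\,f^{X_n\mid X_0,\dots,X_{m(t)}}(y)\,\mathrm dy}{\int_{\mathbb{R}}f^{I_t^{(n)}\mid X_0,\dots,X_{m(t)},X_n=y}(I_t^{(n)})\,f^{X_n\mid X_0,\dots,X_{m(t)}}(y)\,\mathrm dy}.$$ 2. If $(X_0,\dots,X_{m(t)},X_n)$ is a discrete random vector, then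 $$M_t=\frac{\sum_y y\,f^{I_t^{(n)}\mid X_0,\dots,X_{m(t)},X_n=y}(I_t^{(n)})\,\mathbb P[X_n=y\mid X_0,\dots,X_{m(t)}]}{\sum_y f^{I_t^{(n)}\mid X_0,\dots,X_{m(t)},X_n=y}(I_t^{(n)})\,\mathbb P[X_n=y\mid X_0,\dots,X_{m(t)}]}.$$
   Context: Equalities are understood almost surely. Fix dates $0\leqslant T_0<T_1<\dots<T_n<\infty$, $n\geqslant1$; $\{T_0,T_n\}_*:=\{T_0,\dots,T_n\}$, $(T_0,T_n)_*:=\bigcup_{i=0}^{n-1}(T_i,T_{i+1})$, $m(t)=\max\{i:T_i\leqslant t\}$. On a probability space $(\Omega,\mathcal F,\mathbb P)$ let $(D_t)_{t\in[T_0,T_n]}$ (the driver) be a real sample-continuous process such that for all $c\in\mathbb{R}$ and $t\in(T_0,T_n)_*$, $\mathbb P[D_t=c]<1$; standing assumption: $(D_t)$ has a density function on $[T_0,T_n]$. Let $X=(X_0,\dots,X_n)$ be a random vector independent of $(D_t)$ with integrable components whose law is a martingale coupling: $\mathbb{E}[X_n\mid X_0,\dots,X_m]=X_m$ a.s. for all $m=0,\dots,n$. Functions $f_0,\dots,f_n\in C^0([T_0,T_n],\mathbb{R})$ are interpolating coefficients if $f_i(T_i)=1$, $f_i(T_j)=0$ for $i\neq j$. An $X$-randomised arcade process ($X$-RAP) is $I_t^{(n)}=D_t-\sum_{i=0}^n(f_i(t)D_{T_i}-g_i(t)X_i)$, where $f_0,\dots,f_n$ and $g_0,\dots,g_n$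 are interpolating coefficients; $\mathcal F^I_t=\sigma(I_u^{(n)}:T_0\leqslant u\leqslant t)$. It is $\{T_0,T_n\}_*$-conditionally Markov if $\mathbb P[I_t^{(n)}\in\cdot\mid\mathcal F_s^I]=\mathbb P[I_t^{(n)}\in\cdot\mid I_{T_0}^{(n)},\dots,I_{T_{m(s)}}^{(n)},I_s^{(n)}]$ for all $s\leqslant t$ in $[T_0,T_n]$ (note $I^{(n)}_{T_i}=X_i$). Given an $X$-RAP with this property, the $n$-arc filtered arcade martingale is $M_t=\mathbb{E}[X_n\mid\mathcal F_t^I]=\mathbb{E}[X_n\mid X_0,\dots,X_{m(t)},I_t^{(n)}]$. *)

(* Defs.v *)
From HB Require Import structures.
From mathcomp Require Import all_boot all_order all_algebra.
From mathcomp Require Import all_classical all_reals all_analysis.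
Set Implicit Arguments.
Unset Strict Implicit.
Unset Printing Implicit Defensive.
Import Order.TTheory GRing.Theory Num.Theory.
Import numFieldNormedType.Exports.
Local Open Scope classical_set_scope.
Local Open Scope ring_scope.

Section conditioning.
Context d (Omega : measurableType d) (R : realType) (P : probability Omega R).

Definition sigma_of d' (S : measurableType d') (Z : Omega -> S) :
    set (set Omega) :=
  preimage_set_system setT Z measurable.

Definition sigma_process (U : set R) (Y : R -> Omega -> R) : set (set Omega) :=
  <<s \bigcup_(u in U) sigma_of (Y u) >>.

Definition independent_sigma (G H : set (set Omega)) : Prop :=
  forall A B, G A -> H B -> P (A `&` B) = (P A * P B)%E.

(* [Z] is a version of E[Y | G]; [Y] is meant to be integrable and [G] to be
   a sub-sigma-algebra of the measurable sets. *)
Definition is_cond_exp (G : set (set Omega)) (Y Z : Omega -> R) : Prop :=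
  [/\ forall B : set R, measurable B -> G (Z @^-1` B),
      P.-integrable setT (EFin \o Z) &
      forall A, G A ->
        (\int[P]_(w in A) (Z w)%:E = \int[P]_(w in A) (Y w)%:E)%E].

Definition is_cond_prob (G : set (set Omega)) (A : set Omega)
    (Z : Omega -> R) : Prop :=
  is_cond_exp G \1_A Z.

(* [f z] is a density function of [Y] given [Z = z].  Taking [B = setT] makes
   [f (Z w)] integrate to 1 for almost every [w], so that the real-valued
   integrals below are almost surely genuine. *)
Definition is_cond_density d' (S : measurableType d') (Z : Omega -> S)
    (Y : Omega -> R) (f : S -> R -> R) : Prop :=
  [/\ measurable_fun setT (fun zy : S * R => f zy.1 zy.2),
      forall z y, 0 <= f z y &
      forall B : set R, measurable B ->
        is_cond_prob (sigma_of Z) (Y @^-1` B)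
          (fun w => \int[lebesgue_measure]_(y in B) f (Z w) y)].

Definition is_cond_cdf d' (S : measurableType d') (Z : Omega -> S)
    (Y : Omega -> R) (F : S -> cumulativeBounded (0 : R) (1 : R)) : Prop :=
  forall y, is_cond_prob (sigma_of Z) (Y @^-1` `]-oo, y]) (fun w => F (Z w) y).

(* The integral over R^k of a nonnegative measurable function, written as
   k successive integrals over R. *)
Fixpoint iter_int (k : nat) : (k.-tuple R -> \bar R) -> \bar R :=
  match k with
  | 0%N => fun h => h [tuple]
  | k'.+1 => fun h =>
      (\int[lebesgue_measure]_x iter_int (fun v => h [tuple of x :: v]))%E
  end.

Definition has_density k (V : Omega -> k.-tuple R) : Prop :=
  exists p : k.-tuple R -> R,
    [/\ measurable_fun setT p, forall v, 0 <= p v &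
        forall A, measurable A ->
          P (V @^-1` A) = iter_int (fun v => (\1_A v * p v)%:E)].

Definition is_discrete k (V : Omega -> k.-tuple R) : Prop :=
  exists S : set (k.-tuple R), countable S /\ {ae P, forall w, S (V w)}.

Definition atoms (Y : Omega -> R) : set R :=
  [set y | (0 < P (Y @^-1` [set y]))%E].

End conditioning.

(* The library's [esum] is meant for nonnegative terms, hence the split of a
   summable family into its positive and negative parts. *)
Definition rsum (R : realType) (S : set R) (a : R -> R) : R :=
  fine (\esum_(y in S) (Num.max (a y) 0)%:E)
  - fine (\esum_(y in S) (Num.max (- a y) 0)%:E).

Section arcade.
Context (R : realType) (n : nat) (T : 'I_n.+1 -> R).

Definition dates : Prop :=
  0 <= T ord0 /\ {homo T : i j / (i < j)%N >-> i < j}.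

Definition horizon : set R := `[T ord0, T ord_max]%classic.

Definition open_arcs : set R :=
  \bigcup_(i in [set: 'I_n]) `]T (widen_ord (leqnSn n) i), T (lift ord0 i)[%classic.

(* m(t), for t >= T_0; it is [ord0] for t < T_0. *)
Definition last_date (t : R) : 'I_n.+1 :=
  [arg max_(i > ord0 | (T i <= t)%R) (i : nat)]%N.

Definition interpolating (f : 'I_n.+1 -> R -> R) : Prop :=
  (forall i, {within horizon, continuous (f i)}) /\
  (forall i j, f i (T j) = (i == j)%:R).

Context d (Omega : measurableType d) (P : probability Omega R).

(* (Y_0, ..., Y_m(t)) *)
Definition past (Y : 'I_n.+1 -> Omega -> R) (t : R) (w : Omega) :
    (last_date t).+1.-tuple R :=
  [tuple Y (widen_ord (ltn_ord (last_date t)) i) w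
     | i < (last_date t).+1].

Definition driver (D : R -> Omega -> R) : Prop :=
  {ae P, forall w, {within horizon, continuous (fun t => D t w)}} /\
  forall (c : R) (t : R), open_arcs t -> (P (D t @^-1` [set c]) < 1)%E.

Definition marginal_densities (D : R -> Omega -> R) : Prop :=
  forall t, horizon t -> has_density P (fun w => [tuple D t w]).

(* Marginal densities do not make the law of the arcade process at [t]
   absolutely continuous: if [D t = Z] for all [t] and [f 0 + f 1 = 1], then
   [D t - f 0 t * D (T 0) - f 1 t * D (T 1) = 0]. *)
Definition joint_densities (D : R -> Omega -> R) : Prop :=
  forall k (u : k.-tuple R), uniq u -> (forall i, horizon (tnth u i)) ->
    has_density P (fun w => [tuple D (tnth u i) w | i < k]).

Definition martingale_coupling (X : 'I_n.+1 -> Omega -> R) : Prop :=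
  (forall i, P.-integrable setT (EFin \o X i)) /\
  (forall m : 'I_n.+1,
     is_cond_exp P
       (sigma_of (fun w => [tuple X (widen_ord (ltn_ord m) i) w | i < m.+1]))
       (X ord_max) (X m)).

Definition independent_of_driver (X : 'I_n.+1 -> Omega -> R)
    (D : R -> Omega -> R) : Prop :=
  independent_sigma P (sigma_of (fun w => [tuple X i w | i < n.+1]))
    (sigma_process horizon D).

Definition rap (D : R -> Omega -> R) (X : 'I_n.+1 -> Omega -> R)
    (f g : 'I_n.+1 -> R -> R) (t : R) (w : Omega) : R :=
  D t w - \sum_(i < n.+1) (f i t * D (T i) w - g i t * X i w).

Definition history (I : R -> Omega -> R) (t : R) : set (set Omega) :=
  sigma_process `[T ord0, t]%classic I.

(* Almost sure equality of the two conditional probabilities is expressed by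
   a common version. *)
Definition conditionally_markov (I : R -> Omega -> R) : Prop :=
  forall s t, horizon s -> horizon t -> s <= t ->
  forall B : set R, measurable B ->
  exists Z : Omega -> R,
    is_cond_prob P (history I s) (I t @^-1` B) Z /\
    is_cond_prob P
      (sigma_of (fun w => (past (fun i => I (T i)) s w, I s w)))
      (I t @^-1` B) Z.

(* By [conditionally_markov], [M t] is also E[X_n | X_0, ..., X_m(t), I_t]. *)
Definition is_FAM (X : 'I_n.+1 -> Omega -> R) (I M : R -> Omega -> R) : Prop :=
  forall t, horizon t -> is_cond_exp P (history I t) (X ord_max) (M t).

End arcade.

(* Main.v *)
From HB Require Import structures.
Require Import Defs.
From mathcomp Require Import all_boot all_order all_algebra.
From mathcomp Require Import all_classical all_reals all_analysis.
From mathcomp Require Import measurable_realfun.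
Set Implicit Arguments.
Unset Strict Implicit.
Unset Printing Implicit Defensive.
Import Order.TTheory GRing.Theory Num.Theory.
Import numFieldNormedType.Exports.
Local Open Scope classical_set_scope.
Local Open Scope ring_scope.
Local Open Scope ereal_scope.

(** Write Z = (X_0, ..., X_m(t)), Y = X_n and V = I_t.  The Markov property
    between t and T_n says that, given the history up to t, the law of Y
    depends only on (Z, V); hence M_t is the mean of the posterior law of Y
    given (Z, V), and the formula is Bayes' rule for that posterior law: the
    prior is the law of Y given Z, the likelihood of y is h (Z, y) (V), and the
    posterior has the density

      h (Z, y) (V) / N,  N = the integral of h (Z, y) (V) against the prior,

    with respect to the prior.

    The three forms of the formula differ only in how the prior is presented:
    by a distribution function, by a density, or by point masses.  All three
    are instances of one presentation, a kernel k and a weight rho >= 0 such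
    that the law of Y given Z is rho (Z, y) k (Z, dy): the Lebesgue-Stieltjes
    kernel of the distribution function with weight 1, the constant Lebesgue
    kernel with weight p, and the counting measure on the atoms of Y with
    weight q.  The predicate [disintegrates] expresses this, and the formula is
    proved once, in [bayes_mean] and [bayes_mean_given].

    The main steps are these.  [disintegratesE] extends a disintegration from
    rectangles to all nonnegative functions, by a monotone class argument.
    [joint_law_formula] computes the law of (Z, V, Y) by integrating first the
    likelihood and then the prior, and exchanging the two: (Z, V) has a law
    that is absolutely continuous with respect to law(Z) x Lebesgue, with
    density N, which is therefore almost surely positive and finite at (Z, V);
    [posterior_disintegrates] divides by it.  [markov_disintegrates]
    transfers the posterior law from the sigma-algebra of (Z, V) to the whole
    history, and [posterior_mean_ae] identifies M_t, by uniqueness of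
    conditional expectations, with the mean of the posterior law.

    The conditional density h exists when the driver has joint densities.
    Indeed I_t = U + gamma (X), where gamma (X) = sum_i g_i(t) X_i and
    U = D_t - sum_i f_i(t) D_(T_i) is independent of X.  As t is not a date, U is a linear form in the distinct
    marginals D_(T_0), ..., D_(T_n), D_t with coefficient 1 at D_t, so its law
    is absolutely continuous ([density_linear_form_null]).  Given X, the law of
    I_t is a translate of the law of U, and a Radon-Nikodym derivative of
    law(Z, Y, I_t) with respect to law(Z, Y) x Lebesgue is the density sought
    ([cond_density_independent_noise]). *)

(** * A monotone class theorem for functionals *)

Definition nnmeas d (T : measurableType d) (R : realType) (f : T -> \bar R) :=
  (forall x, 0 <= f x) /\ measurable_fun setT f.

(** The abstract properties of an integral of nonnegative functions.  Iterated
    integrals against kernels have them by construction, so two such iterated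
    integrals can be compared without first being turned into measures. *)
Definition integral_like d (T : measurableType d) (R : realType)
    (J : (T -> \bar R) -> \bar R) :=
  [/\ forall f g, nnmeas f -> nnmeas g -> (forall x, f x <= g x) -> J f <= J g,
      forall (c : R) f, (0 <= c)%R -> nnmeas f ->
        J (fun x => c%:E * f x) = c%:E * J f,
      forall f g, nnmeas f -> nnmeas g -> J (f \+ g) = J f + J g &
      forall f : (T -> \bar R)^nat, (forall n, nnmeas (f n)) ->
        (forall x, nondecreasing_seq (f ^~ x)) ->
        J (fun x => limn (f ^~ x)) = limn (fun n => J (f n))].

Section integral_like_unique.
Context d (T : measurableType d) (R : realType).
Implicit Types f g : T -> \bar R.
Import HBNNSimple.

Lemma nnmeas0 : nnmeas ((fun=> 0) : T -> \bar R).
Proof. by split => //; exact: measurable_cst. Qed.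

Lemma nnmeas_indic (A : set T) : measurable A ->
  nnmeas (fun x => (\1_A x : R)%:E).
Proof.
move=> mA; split; first by move=> x; rewrite lee_fin.
by apply/measurable_EFinP; exact: measurable_indic.
Qed.

Lemma nnmeasZ (c : R) f : (0 <= c)%R -> nnmeas f ->
  nnmeas (fun x => c%:E * f x).
Proof.
move=> c0 [f0 mf]; split; last exact: measurable_funeM.
by move=> x; rewrite mule_ge0.
Qed.

Lemma nnmeas_sum I (s : seq I) (F : I -> T -> \bar R) :
  (forall i, nnmeas (F i)) -> nnmeas (fun x => \sum_(i <- s) F i x).
Proof.
move=> nF; split; first by move=> x; apply: sume_ge0 => i _; exact: (nF i).1.
by apply: emeasurable_sum => i; exact: (nF i).2.
Qed.

Lemma integral_like0 (J : (T -> \bar R) -> \bar R) : integral_like J ->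
  J (fun=> 0) = 0.
Proof.
move=> [_ JZ _ _]; transitivity (0%:E * J (fun=> 0)); last by rewrite mul0e.
rewrite -JZ//.
by congr J; apply/funext => x; rewrite mul0e.
Qed.

Lemma integral_like_ge0 (J : (T -> \bar R) -> \bar R) f : integral_like J ->
  nnmeas f -> 0 <= J f.
Proof.
move=> JP nf; rewrite -(integral_like0 JP); case: JP => Jle _ _ _.
by apply: Jle; [exact: nnmeas0|by []|exact: nf.1].
Qed.

Lemma integral_like_sum (J : (T -> \bar R) -> \bar R) I (s : seq I)
    (F : I -> T -> \bar R) : integral_like J ->
  (forall i, nnmeas (F i)) ->
  J (fun x => \sum_(i <- s) F i x) = \sum_(i <- s) J (F i).
Proof.
move=> JP nF; case: (JP) => _ _ JD _.
elim: s => [|i s ih].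
  rewrite big_nil; transitivity (J (fun=> 0)); last exact: integral_like0.
  congr J.
  by apply/funext => x; rewrite big_nil.
rewrite big_cons -ih -JD//; last exact: nnmeas_sum.
by congr J; apply/funext => x; rewrite big_cons.
Qed.

Variables J1 J2 : (T -> \bar R) -> \bar R.
Hypotheses (J1P : integral_like J1) (J2P : integral_like J2).

(** The sets on whose indicators the functionals agree form a Dynkin system,
    so they include all measurable sets; complements need the finite total
    mass, in order to subtract.  Additivity and homogeneity then give simple
    functions, and monotone continuity gives all nonnegative functions. *)
Lemma integral_like_unique (G : set (set T)) :
  J1 (fun x => (\1_setT x)%:E) < +oo ->
  @measurable _ T = <<s G >> -> setI_closed G ->
  (forall A, G A -> J1 (fun x => (\1_A x)%:E) = J2 (fun x => (\1_A x)%:E)) ->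
  J1 (fun x => (\1_setT x)%:E) = J2 (fun x => (\1_setT x)%:E) ->
  forall f, nnmeas f -> J1 f = J2 f.
Proof.
move=> J1T GE GI JG JT.
have [J1le J1Z J1D J1lim] := J1P; have [J2le J2Z J2D J2lim] := J2P.
have indicTE A : (fun x : T => (\1_setT x)%:E) =
    (fun x => (\1_A x : R)%:E) \+ (fun x => (\1_(~` A) x)%:E).
  apply/funext => x /=; rewrite -EFinD indicT indicC.
  by rewrite /cst indicE; case: (x \in A); rewrite /= ?addr0 ?add0r.
have Jm A : measurable A ->
    J1 (fun x => (\1_A x)%:E) = J2 (fun x => (\1_A x)%:E).
  rewrite {1}GE; move: A; apply: (dynkin_induction GE) => //.
  - move=> A mA JA.
    have nA := nnmeas_indic mA; have nCA := nnmeas_indic (measurableC mA).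
    have J1A : J1 (fun x => (\1_A x)%:E) \is a fin_num.
      rewrite ge0_fin_numE ?(integral_like_ge0 J1P)//.
      apply: le_lt_trans J1T; apply: J1le => //; first exact: nnmeas_indic.
      by move=> x; rewrite lee_fin indicT /cst indicE; case: (x \in A).
    move: JT; rewrite (indicTE A) J1D// J2D// -JA => /(congr1 (fun z =>
      z - J1 (fun x => (\1_A x)%:E))).
    by rewrite ![J1 (fun x => (\1_A x)%:E) + _]addeC !addeK.
  - move=> F mF tF JF.
    pose f n x : \bar R := \sum_(0 <= i < n) (\1_(F i) x)%:E.
    have nf n : nnmeas (f n).
      by apply: nnmeas_sum => i; exact: nnmeas_indic.
    have -> : (fun x => (\1_(\bigcup_k F k) x)%:E) =
        (fun x => limn (f ^~ x)) :> (T -> \bar R).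
      by apply/funext => x; rewrite indic_bigcup.
    have ndf x : nondecreasing_seq (f ^~ x).
      by move=> a b ab; apply: lee_sum_nneg_natr => // i _ _; rewrite lee_fin.
    rewrite J1lim// J2lim//; congr (limn _); apply/funext => n.
    have nF i : nnmeas (fun x => (\1_(F i) x : R)%:E) by exact: nnmeas_indic.
    rewrite /f !integral_like_sum//.
    by apply: eq_bigr => i _; rewrite JF.
move=> f [f0 mf].
pose g := nnsfun_approx measurableT mf.
have ng n : nnmeas (EFin \o g n).
  by split=> [x|]; [rewrite /= lee_fin|exact/measurable_EFinP].
have fE : f = (fun x => limn (fun n => (EFin \o g n) x)).
  by apply/funext => x; apply/esym/cvg_lim => //; exact: cvg_nnsfun_approx.
have ndg x : nondecreasing_seq (fun n => (EFin \o g n) x).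
  by move=> a b ab; rewrite /= lee_fin; exact/lefP/nd_nnsfun_approx.
rewrite fE J1lim// J2lim//; congr (limn _); apply/funext => n.
(* The values of [g n] are nonnegative; [Num.max y 0] makes this visible
   for each summand. *)
have gE : EFin \o g n = (fun x =>
    \sum_(y <- finmap.enum_fset (fset_set (range (g n))))
    (Num.max y 0)%:E * (\1_(g n @^-1` [set y]) x)%:E) :> (T -> \bar R).
  apply/funext => x; rewrite /= fimfunE fsbig_finite//= -sumEFin.
  apply: eq_bigr => y _; rewrite -EFinM; congr EFin.
  have [//|y0] := leP 0%R y.
  by rewrite preimage_nnfun0// indic0 !mulr0.
have nI y : nnmeas (fun x => (\1_(g n @^-1` [set y]) x : R)%:E).
  exact: nnmeas_indic.
have y0 (y : R) : (0 <= Num.max y 0)%R by rewrite le_max lexx orbT.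
have nF y : nnmeas (fun x : T =>
    (Num.max y 0)%:E * (\1_(g n @^-1` [set y]) x)%:E : \bar R).
  exact: nnmeasZ.
rewrite gE !integral_like_sum//; apply: eq_bigr => y _.
by rewrite J1Z// J2Z// Jm.
Qed.

End integral_like_unique.

Section integral_like_constructions.
Context {R : realType}.

Lemma integral_like_eval d (T : measurableType d) (x : T) (r : R) :
  (0 <= r)%R -> integral_like (fun f : T -> \bar R => f x * r%:E).
Proof.
move=> r0; split => /=.
- by move=> f g _ _ fg; rewrite lee_wpmul2r// lee_fin.
- by move=> c f _ _; rewrite muleA.
- by move=> f g [f0 _] [g0 _]; rewrite ge0_muleDl.
- move=> f nf ndf; rewrite muleC -limeMl//; last first.
    exact: ereal_nondecreasing_is_cvgn.
  by congr (limn _); apply/funext => n; rewrite muleC.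
Qed.

Lemma integral_like_integral d (T : measurableType d)
    (mu : {measure set T -> \bar R}) (D : set T) : measurable D ->
  integral_like (fun f => \int[mu]_(x in D) f x).
Proof.
move=> mD; split.
- move=> f g [f0 mf] [g0 mg] fg.
  by apply: ge0_le_integral => //; exact: measurable_funTS.
- move=> c f c0 [f0 mf]; rewrite ge0_integralZl_EFin//.
  exact: measurable_funTS.
- move=> f g [f0 mf] [g0 mg].
  by rewrite ge0_integralD//; exact: measurable_funTS.
- move=> f nf ndf; rewrite monotone_convergence//.
  + by move=> n; apply: measurable_funTS; exact: (nf n).2.
  + by move=> n x _; exact: (nf n).1.
Qed.

(** The step that builds iterated integrals: [L f x] is an inner integral
    depending on [x], and [J] is the outer one. *)
Lemma integral_like_comp d (T : measurableType d) d' (T' : measurableType d')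
    (J : (T -> \bar R) -> \bar R) (L : (T' -> \bar R) -> T -> \bar R) :
  integral_like J -> (forall x, integral_like (L ^~ x)) ->
  (forall f, nnmeas f -> nnmeas (L f)) ->
  integral_like (fun f => J (L f)).
Proof.
move=> [Jle JZ JD Jlim] LP nL; split.
- move=> f g nf ng fg; apply: Jle; [exact: nL|exact: nL|move=> x].
  by have [Lle _ _ _] := LP x; exact: Lle.
- move=> c f c0 nf; rewrite -JZ//; last exact: nL.
  by congr J; apply/funext => x; have [_ LZ _ _] := LP x; exact: LZ.
- move=> f g nf ng; rewrite -JD//; [|exact: nL..].
  by congr J; apply/funext => x; have [_ _ LD _] := LP x; exact: LD.
- move=> f nf ndf; rewrite -Jlim//.
  + by congr J; apply/funext => x; have [_ _ _ Llim] := LP x; exact: Llim.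
  + by move=> n; exact: nL.
  + move=> x m n mn; have [Lle _ _ _] := LP x; apply: Lle => //.
    by move=> y; exact: ndf.
Qed.

End integral_like_constructions.

(** * Kernels and disintegrations *)

Section kernels.
Context d1 d2 (X : measurableType d1) (Y : measurableType d2) (R : realType).

Definition kcst (m : {measure set Y -> \bar R}) (x : X) :
  {measure set Y -> \bar R} := m.

Let measurable_kcst m U : measurable U -> measurable_fun setT ((kcst m) ^~ U).
Proof. by move=> mU; exact: measurable_cst. Qed.

HB.instance Definition _ m :=
  isKernel.Build _ _ _ _ _ (kcst m) (measurable_kcst m).

Let kcst_sfinite (m : {sfinite_measure set Y -> \bar R}) :
  exists2 s : (R.-ker X ~> Y)^nat, forall n, measure_fam_uub (s n) &
    forall x U, measurable U -> kcst m x U = kseries s x U.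
Proof.
exists (fun n => kcst (sfinite_measure_seq m n)).
  move=> n; exists (fine (sfinite_measure_seq m n setT) + 1)%R => x.
  by rewrite EFinD fineK ?fin_num_measure// lteDl ?fin_num_measure.
by move=> x U mU; exact: sfinite_measure_seqP.
Qed.

HB.instance Definition _ (m : {sfinite_measure set Y -> \bar R}) :=
  isSFiniteKernel_subdef.Build _ _ _ _ _ (kcst m) (kcst_sfinite m).

End kernels.

Section kernel_pullback.
Context d0 d1 d2 (X0 : measurableType d0) (X : measurableType d1)
  (Y : measurableType d2) (R : realType).
Variables (f : X0 -> X) (mf : measurable_fun setT f).

(** The measurability of [f] is an argument so that the kernel structure below
    can be inferred from the term alone. *)
Definition kpull of measurable_fun setT f :=
  fun (k : X -> {measure set Y -> \bar R}) (x : X0) => k (f x).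

Let measurable_kpull (k : R.-ker X ~> Y) U :
  measurable U -> measurable_fun setT ((kpull mf k) ^~ U).
Proof.
by move=> mU; exact: (measurableT_comp (measurable_kernel k U mU) mf).
Qed.

HB.instance Definition _ (k : R.-ker X ~> Y) :=
  isKernel.Build _ _ _ _ _ (kpull mf k) (measurable_kpull k).

Let kpull_sfinite (k : R.-sfker X ~> Y) :
  exists2 s : (R.-ker X0 ~> Y)^nat, forall n, measure_fam_uub (s n) &
    forall x U, measurable U -> kpull mf k x U = kseries s x U.
Proof.
have [s kE] := sfinite_kernel k.
exists (fun n => kpull mf (s n)).
  by move=> n; have [r sr] := measure_uub (s n); exists r => x; exact: sr.
by move=> x U mU; rewrite /kpull kE.
Qed.

HB.instance Definition _ (k : R.-sfker X ~> Y) :=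
  isSFiniteKernel_subdef.Build _ _ _ _ _ (kpull mf k) (kpull_sfinite k).

End kernel_pullback.

Section disintegration.
Context d (Omega : measurableType d) (R : realType) (P : probability Omega R).
Context ds (S : measurableType ds) dy (Ty : measurableType dy).

(** On the event [A], the law of [Y] given [Z = z] is [r (z, y) k (z, dy)].
    The event [A] lets the same notion express that this remains true
    conditionally on more information than [Z]: it then holds for every [A] of
    a larger sigma-algebra. *)
Definition disintegrates (A : set Omega) (Z : Omega -> S) (Y : Omega -> Ty)
    (k : S -> {measure set Ty -> \bar R}) (r : S * Ty -> R) :=
  forall C B, measurable C -> measurable B ->
    P (A `&` Z @^-1` C `&` Y @^-1` B) =
    \int[P]_(w in A `&` Z @^-1` C) \int[k (Z w)]_(y in B) (r (Z w, y))%:E.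

Variables (A : set Omega) (Z : Omega -> S) (Y : Omega -> Ty).
Variables (k : R.-sfker S ~> Ty) (r : S * Ty -> R).
Hypotheses (mA : measurable A) (mZ : measurable_fun setT Z).
Hypotheses (mY : measurable_fun setT Y) (mr : measurable_fun setT r).
Hypothesis r0 : forall x, (0 <= r x)%R.

Lemma nnmeas_kernel (phi : S * Ty -> \bar R) : nnmeas phi ->
  nnmeas (fun z => \int[k z]_y phi (z, y)).
Proof.
move=> [phi0 mphi]; split; first by move=> z; exact: integral_ge0.
exact: measurable_fun_integral_sfinite_kernel.
Qed.

Lemma nnmeasM_weight (phi : S * Ty -> \bar R) : nnmeas phi ->
  nnmeas (fun zy => phi zy * (r zy)%:E).
Proof.
move=> [phi0 mphi]; split; first by move=> z; rewrite mule_ge0// lee_fin.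
by apply: emeasurable_funM => //; exact/measurable_EFinP.
Qed.

(** Both sides are integral-like in [phi], and they agree on indicators of
    rectangles. *)
Lemma disintegratesE : disintegrates A Z Y k r ->
  forall phi : S * Ty -> \bar R, nnmeas phi ->
  \int[P]_(w in A) phi (Z w, Y w) =
  \int[P]_(w in A) \int[k (Z w)]_y (phi (Z w, y) * (r (Z w, y))%:E).
Proof.
move=> ZY phi nphi.
have mZY : measurable_fun setT (fun w => (Z w, Y w)).
  exact: measurable_fun_pair.
pose J1 (f : S * Ty -> \bar R) := \int[P]_(w in A) f (Z w, Y w).
pose J2 (f : S * Ty -> \bar R) :=
  \int[P]_(w in A) \int[k (Z w)]_y (f (Z w, y) * (r (Z w, y))%:E).
have J1P : integral_like J1.
  apply: (integral_like_comp (L := fun f w => f (Z w, Y w))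
    (integral_like_integral P mA)).
    move=> w; have := integral_like_eval (Z w, Y w) (@ler01 R).
    by under eq_fun do rewrite mule1.
  by move=> f [f0 mf]; split => //; exact: measurableT_comp.
have J2P : integral_like J2.
  apply: (integral_like_comp
    (L := fun f w => \int[k (Z w)]_y (f (Z w, y) * (r (Z w, y))%:E))
    (integral_like_integral P mA)).
    move=> w; apply: (integral_like_comp
      (L := fun f y => f (Z w, y) * (r (Z w, y))%:E)
      (integral_like_integral (k (Z w)) measurableT)).
      by move=> y; exact: integral_like_eval.
    move=> f [f0 mf]; split; first by move=> y; rewrite mule_ge0// lee_fin.
    apply: emeasurable_funM; first exact: measurableT_comp.
    exact/measurable_EFinP/measurableT_comp.
  move=> f nf; have [h0 mh] := nnmeas_kernel (nnmeasM_weight nf).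
  by split => [w|]; [exact: h0|exact: (measurableT_comp mh mZ)].
have rect C B : measurable C -> measurable B ->
    J1 (fun x => (\1_(C `*` B) x)%:E) = J2 (fun x => (\1_(C `*` B) x)%:E).
  move=> mC mB; have mAC : measurable (Z @^-1` C).
    by rewrite -[X in measurable X]setTI; exact: mZ.
  transitivity (P (A `&` Z @^-1` C `&` Y @^-1` B)).
    rewrite /J1 (eq_integral (fun w => (\1_(Z @^-1` C `&` Y @^-1` B) w)%:E)).
      rewrite integral_indic//; last first.
        by apply: measurableI => //; rewrite -[X in measurable X]setTI; exact: mY.
      by congr (P _); rewrite setIC setIA.
    move=> w _; rewrite !indicE; congr (nat_of_bool _)%:R%:E.
  rewrite ZY// /J2 integral_mkcondr; apply: eq_integral => w _.
  rewrite patchE; case: ifPn => wC.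
    rewrite integral_mkcond; apply: eq_integral => y _.
    rewrite patchE indicE; have -> : ((Z w, y) \in C `*` B) = (y \in B).
      apply/idP/idP; rewrite !inE; first by case.
      by move=> yB; split => //; move: wC; rewrite inE.
    by case: (y \in B); rewrite ?mul1e ?mul0e.
  rewrite integral0_eq// => y _; rewrite indicE.
  have -> : ((Z w, y) \in C `*` B) = false.
    by apply/negP; rewrite inE => -[Cw _]; move/negP: wC; apply; rewrite inE.
  by rewrite mul0e.
apply: (integral_like_unique J1P J2P (G := [set C `*` B |
  C in measurable & B in measurable])) => //.
- rewrite /J1 (eq_integral (cst 1)); last by move=> w _; rewrite indicT.
  by rewrite integral_cst// mul1e (le_lt_trans (probability_le1 _ _)) ?ltry.
- exact: measurable_prod_measurableType.
- move=> _ _ [C1 mC1 [B1 mB1 <-]] [C2 mC2 [B2 mB2 <-]].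
  exists (C1 `&` C2); first exact: measurableI.
  by exists (B1 `&` B2); [exact: measurableI|rewrite setXI].
- by move=> _ [C mC [B mB <-]]; exact: rect.
- by rewrite -setXTT; exact: rect.
Qed.

End disintegration.

(** * Conditional expectations given a sub-sigma-algebra *)

(** Where [f] is positive, the inverse is the power -1, which is measurable; at
    0 both are 0. *)
Lemma measurable_inv_ge0 d (T : measurableType d) (R : realType) (f : T -> R) :
  (forall x, (0 <= f x)%R) -> measurable_fun setT f ->
  measurable_fun setT (fun x => (f x)^-1%R).
Proof.
move=> f0 mf; apply: (eq_measurable_fun (fun x => f x `^ (-1))%R).
  by move=> x _; rewrite powR_inv1.
exact: (measurableT_comp (measurable_powR (-1)) mf).
Qed.

Section sub_sigma_algebra.
Context d (Omega : measurableType d) (R : realType) (P : probability Omega R).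

Lemma sigma_ofP ds (S : measurableType ds) (Z : Omega -> S) A :
  sigma_of Z A <-> exists2 C, measurable C & A = Z @^-1` C.
Proof.
split=> [[C mC <-]|[C mC ->]]; first by exists C => //; rewrite setTI.
by exists C => //; rewrite setTI.
Qed.

Lemma sigma_algebra_sigma_of ds (S : measurableType ds) (Z : Omega -> S) :
  sigma_algebra setT (sigma_of Z).
Proof. exact/sigma_algebra_preimage/sigma_algebra_measurable. Qed.

Lemma sigma_of_measurable ds (S : measurableType ds) (Z : Omega -> S) :
  measurable_fun setT Z -> sigma_of Z `<=` measurable.
Proof. by move=> mZ _ [C mC <-]; exact: mZ. Qed.

Lemma sigma_of_comp ds (S : measurableType ds) dt (T : measurableType dt)
    (Z : Omega -> S) (f : S -> T) B : measurable_fun setT f -> measurable B ->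
  sigma_of Z ((f \o Z) @^-1` B).
Proof.
move=> mf mB; apply/sigma_ofP; exists (f @^-1` B) => //.
by rewrite -[X in measurable X]setTI; exact: mf.
Qed.

Lemma sub_sigma_algebra_lt (G : set (set Omega)) (Z1 Z2 : Omega -> R) :
  sigma_algebra setT G ->
  (forall B, measurable B -> G (Z1 @^-1` B)) ->
  (forall B, measurable B -> G (Z2 @^-1` B)) ->
  G [set w | (Z1 w < Z2 w)%R].
Proof.
move=> sG G1 G2; rewrite -(sigma_algebra_id sG).
have m1 : measurable_fun setT (Z1 : g_sigma_algebraType G -> R).
  by move=> _ B mB; rewrite setTI; apply: sub_sigma_algebra; exact: G1.
have m2 : measurable_fun setT (Z2 : g_sigma_algebraType G -> R).
  by move=> _ B mB; rewrite setTI; apply: sub_sigma_algebra; exact: G2.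
have mtrue : measurable [set true] by [].
have := measurable_fun_ltr m1 m2 measurableT mtrue.
rewrite setTI; congr (<<s _ >> _); apply/seteqP; split => w //=.
Qed.

(** [Z2 - Z1] is positive on [A] and has integral 0 there. *)
Lemma ae_le_of_integral (Z1 Z2 : Omega -> R) :
  P.-integrable setT (EFin \o Z1) -> P.-integrable setT (EFin \o Z2) ->
  let A := [set w | (Z1 w < Z2 w)%R] in measurable A ->
  \int[P]_(w in A) (Z1 w)%:E = \int[P]_(w in A) (Z2 w)%:E ->
  {ae P, forall w, (Z2 w <= Z1 w)%R}.
Proof.
move=> i1 i2 A mA Z12.
have i1A : P.-integrable A (EFin \o Z1) by exact: integrableS i1.
have i2A : P.-integrable A (EFin \o Z2) by exact: integrableS i2.
have mB := measurable_int _ (integrableB mA i2A i1A).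
have : \int[P]_(w in A) `|((EFin \o Z2) \- (EFin \o Z1)) w| = 0.
  rewrite (eq_integral ((EFin \o Z2) \- (EFin \o Z1))).
    rewrite integralB_EFin// Z12 subee//.
    exact: integrable_fin_num i2A.
  move=> w; rewrite inE => Aw; rewrite gee0_abs//.
  by rewrite /= -EFinB lee_fin subr_ge0 ltW.
move/(ae_eq_integral_abs _ mA mB); apply: filterS => w /= h.
rewrite leNgt; apply/negP => Aw; have := h Aw.
by rewrite -EFinB => -[] /eqP; rewrite subr_eq0 => /eqP E; move: Aw; rewrite E ltxx.
Qed.

(** The event where one version is smaller than the other belongs to [G], and
    the two versions have the same integral over it. *)
Lemma cond_exp_unique (G : set (set Omega)) (Y Z1 Z2 : Omega -> R) :
  sigma_algebra setT G -> G `<=` measurable ->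
  is_cond_exp P G Y Z1 -> is_cond_exp P G Y Z2 ->
  {ae P, forall w, Z1 w = Z2 w}.
Proof.
move=> sG Gm [G1 i1 E1] [G2 i2 E2].
have G12 := sub_sigma_algebra_lt sG G1 G2.
have G21 := sub_sigma_algebra_lt sG G2 G1.
have := ae_le_of_integral i1 i2 (Gm _ G12) (etrans (E1 _ G12) (esym (E2 _ G12))).
have := ae_le_of_integral i2 i1 (Gm _ G21) (etrans (E2 _ G21) (esym (E1 _ G21))).
by apply: filterS2 => w h1 h2; apply/eqP; rewrite eq_le h1 h2.
Qed.

Lemma cond_prob_integral (G : set (set Omega)) (B A : set Omega) Z :
  measurable B -> G `<=` measurable -> is_cond_prob P G B Z -> G A ->
  \int[P]_(w in A) (Z w)%:E = P (A `&` B).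
Proof.
move=> mB Gm [_ _ E] GA; rewrite E// integral_indic//; last exact: Gm.
by rewrite setIC.
Qed.

Lemma cond_prob_setT (G : set (set Omega)) (Z : Omega -> R) :
  sigma_algebra setT G -> G `<=` measurable -> is_cond_prob P G setT Z ->
  {ae P, forall w, Z w = 1%R}.
Proof.
move=> sG Gm hZ; apply: (cond_exp_unique sG Gm hZ); split.
- case: sG => G0 GC _ B mB; rewrite preimage_cst; case: ifPn => _ //.
  by rewrite -[setT](@setD0 _ setT); exact: GC.
- exact: finite_measure_integrable_cst.
- by move=> A GA; apply: eq_integral => w _; rewrite indicT.
Qed.

(** The definition of a conditional density speaks of real-valued integrals,
    which are 0 when the integral is infinite.  The case [B = setT] excludes
    this: the integral of [f (Z w)] over the line is almost surely 1, hence
    finite, and so are the integrals over all [B]. *)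
Lemma cond_density_disintegrates ds (S : measurableType ds) (Z : Omega -> S)
    (Y : Omega -> R) (f : S -> R -> R) :
  measurable_fun setT Z -> measurable_fun setT Y -> is_cond_density P Z Y f ->
  disintegrates (Ty := measurableTypeR R) P setT Z Y (kcst lebesgue_measure)
    (fun zy => f zy.1 zy.2).
Proof.
move=> mZ mY [mf f0 hf] C B mC mB; rewrite setTI.
have mfZ w D : measurable_fun D (fun y => (f (Z w) y)%:E).
  apply/measurable_EFinP/measurable_funTS.
  exact: (measurableT_comp mf (pair1_measurable (Z w))).
have mYB : measurable (Y @^-1` B) by rewrite -[X in measurable X]setTI; exact: mY.
have GC : sigma_of Z (Z @^-1` C) by apply/sigma_ofP; exists C.
have Gm := sigma_of_measurable mZ.
rewrite -(cond_prob_integral mYB Gm (hf B mB) GC).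
have hT := hf setT measurableT; rewrite preimage_setT in hT.
have := cond_prob_setT (sigma_algebra_sigma_of Z) Gm hT.
have mF D : measurable D -> measurable_fun setT
    (fun w => \int[lebesgue_measure]_(y in D) (f (Z w) y)%:E).
  move=> mD; under eq_fun do rewrite integral_mkcond.
  apply: (measurableT_comp (f := fun z => \int[lebesgue_measure]_y
    ((fun y => (f z y)%:E) \_ D) y)) => //.
  pose phi (zy : S * measurableTypeR R) := (f zy.1 zy.2 * \1_D zy.2)%:E.
  rewrite (_ : (fun z => _) = fun z => \int[kcst lebesgue_measure z]_y phi (z, y)).
    apply: measurable_fun_integral_sfinite_kernel.
      by move=> zy; rewrite lee_fin mulr_ge0.
    apply/measurable_EFinP/measurable_funM => //.
    exact: (measurableT_comp (measurable_indic _) measurable_snd).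
  apply/funext => z; apply: eq_integral => y _; rewrite patchE /phi /= indicE.
  by case: (y \in D); rewrite ?mulr1 ?mulr0.
move=> h1; apply: ae_eq_integral => //.
- exact: Gm.
- apply/measurable_EFinP/measurable_funTS.
  by apply: measurableT_comp => //; exact: mF.
- by apply: measurable_funTS; exact: mF.
apply: filterS h1 => w h1 _; rewrite fineK// ge0_fin_numE; last first.
  by apply: integral_ge0 => y _; rewrite lee_fin.
apply: (@le_lt_trans _ _ (\int[lebesgue_measure]_y (f (Z w) y)%:E)).
  apply: ge0_subset_integral => //; first exact: mfZ.
  by move=> y _; rewrite lee_fin.
rewrite ltey; apply/eqP => h; move: h1; rewrite /Rintegral h /= => /esym/eqP.
by rewrite oner_eq0.
Qed.

End sub_sigma_algebra.

(** * Bayes' rule *)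

(** [Z] is the known information, [Y] the unknown with prior
    [rho (Z, y) k (Z, dy)], and [V] the observation, with likelihood [h] with
    respect to [nu]. *)
Section bayes.
Context d (Omega : measurableType d) (R : realType) (P : probability Omega R).
Context ds (S : measurableType ds) dy (Ty : measurableType dy).
Context du (U : measurableType du).
Variable nu : {sigma_finite_measure set U -> \bar R}.
Variables (Z : Omega -> S) (Y : Omega -> Ty) (V : Omega -> U).
Hypotheses (mZ : measurable_fun setT Z) (mY : measurable_fun setT Y).
Hypothesis mV : measurable_fun setT V.
Variables (k : R.-sfker S ~> Ty) (rho : S * Ty -> R) (h : S * Ty * U -> R).
Hypotheses (mrho : measurable_fun setT rho) (rho0 : forall x, (0 <= rho x)%R).
Hypotheses (mh : measurable_fun setT h) (h0 : forall x, (0 <= h x)%R).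
Hypothesis HY : disintegrates P setT Z Y k rho.
Hypothesis HV : disintegrates P setT (fun w => (Z w, Y w)) V (kcst nu) h.

Definition joint_weight (vy : S * U * Ty) : R :=
  (h (vy.1.1, vy.2, vy.1.2) * rho (vy.1.1, vy.2))%R.

Lemma measurable_joint_weight : measurable_fun setT joint_weight.
Proof.
have m11 : measurable_fun setT (fun vy : S * U * Ty => vy.1.1).
  exact: measurableT_comp.
apply: measurable_funM.
  apply: measurableT_comp => //; apply: measurable_fun_pair; last first.
    exact: measurableT_comp.
  exact: measurable_fun_pair.
by apply: measurableT_comp => //; exact: measurable_fun_pair.
Qed.

Lemma joint_weight_ge0 vy : (0 <= joint_weight vy)%R.
Proof. by rewrite mulr_ge0. Qed.

(** For [b = 1] this is the density of [(Z, V)] with respect to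
    law(Z) x [nu]; the quotient of the case of [b] by the case of 1 is the
    posterior mean of [b]. *)
Definition weighted_integral (b : Ty -> \bar R) (v : S * U) :=
  \int[k v.1]_y (b y * (joint_weight (v, y))%:E).

Local Notation N := weighted_integral.

Lemma nnmeas_weighted_integral b : nnmeas b -> nnmeas (N b).
Proof.
move=> [b0 mb].
apply: (nnmeas_kernel (kpull (@measurable_fst _ _ S U) k)
  (phi := fun vy => b vy.2 * (joint_weight vy)%:E)).
split=> [vy|]; first by rewrite mule_ge0// lee_fin joint_weight_ge0.
apply: emeasurable_funM; first exact: measurableT_comp.
by apply/measurable_EFinP; exact: measurable_joint_weight.
Qed.

(* Each [k z] has to be an s-finite measure for Fubini's theorem. *)
Let kz_sfinite z := isSFinite.Build _ _ _ (k z) (sfinite_kernel_measure k z).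
Let kz z : {sfinite_measure set Ty -> \bar R} :=
  HB.pack (k z : set Ty -> \bar R) (Measure.class (k z)) (kz_sfinite z).

(** Disintegrating [V] given [(Z, Y)], then [Y] given [Z], yields the integrals
    in the order [P], [k], [nu]; Fubini's theorem exchanges the last two. *)
Lemma joint_law_formula (psi : S * U -> \bar R) (b : Ty -> \bar R) :
  nnmeas psi -> nnmeas b ->
  \int[P]_w (psi (Z w, V w) * b (Y w)) =
  \int[P \x nu]_p (psi (Z p.1, p.2) * N b (Z p.1, p.2)).
Proof.
move=> [psi0 mpsi] [b0 mb]; have [N0 mN] := nnmeas_weighted_integral (conj b0 mb).
have mpsi' : measurable_fun setT (fun x : S * Ty * U => psi (x.1.1, x.2)).
  apply: measurableT_comp => //; apply: measurable_fun_pair => //.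
  exact: measurableT_comp.
have mb' : measurable_fun setT (fun x : S * Ty * U => b x.1.2).
  by apply: measurableT_comp => //; exact: measurableT_comp.
have nphi : nnmeas (fun x : S * Ty * U => psi (x.1.1, x.2) * b x.1.2).
  by split=> [x|]; [rewrite mule_ge0|exact: emeasurable_funM].
rewrite (disintegratesE measurableT _ _ mh h0 HV nphi)//; last exact: measurable_fun_pair.
have ng := nnmeas_kernel (kcst nu) (nnmeasM_weight mh h0 nphi).
rewrite /= in ng *.
rewrite (disintegratesE measurableT _ _ mrho rho0 HY ng)//=.
rewrite fubini_tonelli1//=; last 2 first.
- apply: emeasurable_funM.
    apply: measurableT_comp => //; apply: measurable_fun_pair => //.
    exact: measurableT_comp.
  apply: measurableT_comp => //; apply: measurable_fun_pair => //.
  exact: measurableT_comp.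
- by move=> p; rewrite mule_ge0.
apply: eq_integral => w _; rewrite /fubini_F /=.
pose F (yi : Ty * U) := psi (Z w, yi.2) * (b yi.1 *
  (joint_weight (Z w, yi.2, yi.1))%:E).
have F0 yi : 0 <= F yi.
  by rewrite /F !mule_ge0// lee_fin joint_weight_ge0.
have mF : measurable_fun setT F.
  apply: emeasurable_funM.
    exact: (measurableT_comp mpsi (measurableT_comp (pair1_measurable _) _)).
  apply: emeasurable_funM; first exact: measurableT_comp.
  apply/measurable_EFinP/(measurableT_comp measurable_joint_weight).
  apply: measurable_fun_pair => //.
  exact: (measurableT_comp (pair1_measurable _)).
transitivity (\int[kz (Z w)]_y \int[nu]_i F (y, i)).
  apply: eq_integral => y _; rewrite -ge0_integralZr//.
  - apply: eq_integral => i _; rewrite /F /joint_weight /= EFinM.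
    by rewrite !muleA.
  - have [_ mg] := nnmeasM_weight mh h0 nphi.
    exact: (measurableT_comp mg (pair1_measurable (Z w, y))).
  - move=> i _; have [g0 _] := nnmeasM_weight mh h0 nphi.
    exact: (g0 (Z w, y, i)).
  - by rewrite lee_fin.
apply: (etrans (sfinite_Fubini (kz (Z w)) nu F F0 mF)); apply: eq_integral => i _.
rewrite /weighted_integral /F /= ge0_integralZl//.
- apply: emeasurable_funM => //.
  apply/measurable_EFinP/(measurableT_comp measurable_joint_weight).
  exact: pair1_measurable.
- by move=> y _; rewrite mule_ge0// lee_fin joint_weight_ge0.
Qed.

Local Notation D := (N (fun=> 1)).

Lemma nnmeas1 : nnmeas ((fun=> 1) : Ty -> \bar R).
Proof. by split => //; exact: measurable_cst. Qed.

(** By [joint_law_formula] the law of [(Z, V)] is absolutely continuous with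
    respect to law(Z) x [nu]. *)
Lemma joint_ae (Q : set (S * U)) : measurable Q ->
  {ae P \x nu, forall p, Q (Z p.1, p.2)} -> {ae P, forall w, Q (Z w, V w)}.
Proof.
move=> mQ aeQ; have mZI := measurable_fun_pair mZ mV.
have mA : measurable ((fun w => (Z w, V w)) @^-1` (~` Q)).
  by rewrite -[X in measurable X]setTI; apply: mZI => //; exact: measurableC.
exists ((fun w => (Z w, V w)) @^-1` (~` Q)); split => //.
have nQ := nnmeas_indic R (measurableC mQ).
have := joint_law_formula nQ nnmeas1.
rewrite (eq_integral (fun w => (\1_((fun w => (Z w, V w)) @^-1` (~` Q)) w)%:E));
  last by move=> w _; rewrite mule1.
rewrite integral_indic// setIT => ->.
have [D0 mD] := nnmeas_weighted_integral nnmeas1.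
have mZp : measurable_fun setT (fun p : Omega * U => (Z p.1, p.2)).
  by apply: measurable_fun_pair => //; exact: measurableT_comp.
rewrite (ge0_ae_eq_integral (g := cst 0))//; first by rewrite integral0.
- apply: emeasurable_funM; first exact: (measurableT_comp nQ.2 mZp).
  exact: (measurableT_comp mD mZp).
- by move=> p _; rewrite mule_ge0// lee_fin.
- apply: filterS aeQ => p Qp _ /=.
  by rewrite indicE memNset ?mul0e// => -[].
Qed.

Lemma weighted_integral_ae_lty b : nnmeas b -> \int[P]_w b (Y w) < +oo ->
  {ae P \x nu, forall p, N b (Z p.1, p.2) < +oo}.
Proof.
move=> nb boo; have [N0 mN] := nnmeas_weighted_integral nb.
have n1 : nnmeas ((fun=> 1) : S * U -> \bar R).
  by split => //; exact: measurable_cst.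
have mZp : measurable_fun setT (fun p : Omega * U => (Z p.1, p.2)).
  by apply: measurable_fun_pair => //; exact: measurableT_comp.
have iN : (P \x nu).-integrable setT (fun p => N b (Z p.1, p.2)).
  apply/integrableP; split; first exact: (measurableT_comp mN mZp).
  suff -> : \int[P \x nu]_p `|N b (Z p.1, p.2)| = \int[P]_w b (Y w) by [].
  transitivity (\int[P]_w (1 * b (Y w))).
    rewrite [RHS](joint_law_formula n1 nb); apply: eq_integral => p _.
    by rewrite gee0_abs// mul1e.
  by apply: eq_integral => w _; rewrite mul1e.
apply: filterS (integrable_ae measurableT iN) => p /(_ Logic.I) /=.
by rewrite ge0_fin_numE.
Qed.

(** The integral of [N b] against law(Z) x [nu] is the expectation of
    [b (Y)], so [N b] is finite almost everywhere for law(Z) x [nu], hence also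
    for the law of [(Z, V)]. *)
Lemma joint_weighted_integral_lty b : nnmeas b -> \int[P]_w b (Y w) < +oo ->
  {ae P, forall w, N b (Z w, V w) < +oo}.
Proof.
move=> nb boo; have [N0 mN] := nnmeas_weighted_integral nb.
apply: (joint_ae (Q := [set v | N b v < +oo])).
  by rewrite -[X in measurable X]setTI; exact: emeasurable_fun_infty_o.
exact: weighted_integral_ae_lty.
Qed.

Lemma integral_probability1 : \int[P]_w (cst 1 w) < +oo :> \bar R.
Proof. by rewrite integral_cst// mul1e (le_lt_trans (probability_le1 _ _)) ?ltry. Qed.

(** [D] is the density of [(Z, V)], and a density is almost surely positive
    at the random point that it describes. *)
Lemma joint_marginal_gt0 : {ae P, forall w, 0 < D (Z w, V w)}.
Proof.
have [D0 mD] := nnmeas_weighted_integral nnmeas1.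
have mE : measurable [set v | D v = 0].
  rewrite -[X in measurable X]setTI.
  exact: (mD measurableT _ (emeasurable_set1 0)).
have mZI := measurable_fun_pair mZ mV.
exists ((fun w => (Z w, V w)) @^-1` [set v | D v = 0]); split.
- by rewrite -[X in measurable X]setTI; exact: mZI.
- have nE := nnmeas_indic R mE.
  have := joint_law_formula nE nnmeas1.
  rewrite (eq_integral (fun w =>
    (\1_((fun w => (Z w, V w)) @^-1` [set v | D v = 0]) w)%:E));
    last by move=> w _; rewrite mule1.
  rewrite integral_indic//; last first.
    by rewrite -[X in measurable X]setTI; exact: mZI.
  rewrite setIT => ->; apply: integral0_eq => p _.
  rewrite indicE; have [|_] := boolP (_ \in _); last by rewrite mul0e.
  by rewrite inE /= => ->; rewrite mule0.
- by move=> w /= /negP; rewrite lt0e D0 andbT negbK => /eqP.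
Qed.

Definition posterior_weight (vy : S * U * Ty) : R :=
  (joint_weight vy / fine (D vy.1))%R.

Lemma measurable_posterior_weight : measurable_fun setT posterior_weight.
Proof.
have [D0 mD] := nnmeas_weighted_integral nnmeas1.
apply: measurable_funM; first exact: measurable_joint_weight.
apply: measurable_inv_ge0; first by move=> vy; rewrite fine_ge0.
apply: measurableT_comp => //.
exact: (measurableT_comp mD (measurable_fst)).
Qed.

Lemma posterior_weight_ge0 vy : (0 <= posterior_weight vy)%R.
Proof.
have [D0 mD] := nnmeas_weighted_integral nnmeas1.
by rewrite divr_ge0 ?joint_weight_ge0// fine_ge0.
Qed.

Lemma posterior_integralE b v : nnmeas b ->
  \int[k v.1]_y (b y * (posterior_weight (v, y))%:E) =
  N b v * ((fine (D v))^-1)%:E.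
Proof.
move=> [b0 mb]; have [D0 mD] := nnmeas_weighted_integral nnmeas1.
rewrite -ge0_integralZr//.
- by apply: eq_integral => y _; rewrite /posterior_weight EFinM muleA.
- apply: emeasurable_funM => //.
  apply/measurable_EFinP/(measurableT_comp measurable_joint_weight).
  exact: pair1_measurable.
- by move=> y _; rewrite mule_ge0// lee_fin joint_weight_ge0.
- by rewrite lee_fin invr_ge0 fine_ge0.
Qed.

(** Both sides become integrals against law(Z) x [nu] by
    [joint_law_formula].  There the factor [D] of the density of [(Z, V)]
    cancels the denominator of the posterior weight; where [D = 0] nothing
    cancels, but the numerator also vanishes, being at most [D]. *)
Lemma posterior_disintegrates :
  disintegrates P setT (fun w => (Z w, V w)) Y
    (kpull (@measurable_fst _ _ S U) k) posterior_weight.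
Proof.
move=> C B mC mB; have mZI := measurable_fun_pair mZ mV.
have mVC : measurable ((fun w => (Z w, V w)) @^-1` C).
  by rewrite -[X in measurable X]setTI; exact: mZI.
have mYB : measurable (Y @^-1` B) by rewrite -[X in measurable X]setTI; exact: mY.
have nC := nnmeas_indic R mC; have nB := nnmeas_indic R mB.
have [D0 mD] := nnmeas_weighted_integral nnmeas1.
have [N0 mN] := nnmeas_weighted_integral nB.
pose nB' v := N (fun y => (\1_B y)%:E) v * ((fine (D v))^-1)%:E.
have nCB : nnmeas (fun v => (\1_C v)%:E * nB' v).
  split=> [v|].
    by rewrite !mule_ge0// lee_fin// invr_ge0 fine_ge0.
  apply: emeasurable_funM; first exact: nC.2.
  apply: emeasurable_funM => //; apply/measurable_EFinP.
  apply: measurable_inv_ge0; first by move=> v; rewrite fine_ge0.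
  exact: measurableT_comp.
rewrite setTI.
transitivity (\int[P]_w ((\1_C (Z w, V w))%:E * (\1_B (Y w))%:E)).
  rewrite (eq_integral (fun w => (\1_((fun w => (Z w, V w)) @^-1` C `&` Y @^-1` B) w)%:E)).
    by rewrite integral_indic ?setIT//; exact: measurableI.
  by move=> w _; rewrite -EFinM indicI.
rewrite (joint_law_formula nC nB).
transitivity (\int[P]_w ((\1_C (Z w, V w))%:E * nB' (Z w, V w) * 1)); last first.
  rewrite [RHS]integral_mkcond; apply: eq_integral => w _.
  rewrite mule1 patchE; case: ifPn => wC; last first.
    by rewrite indicE (_ : (_ \in C) = false) ?mul0e//; apply/negbTE.
  rewrite indicE (_ : (_ \in C) = true) ?mul1e//.
  rewrite /nB' -posterior_integralE// [RHS]integral_mkcond.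
  apply: eq_integral => y _; rewrite patchE indicE.
  by case: (y \in B); rewrite ?mul1e ?mul0e.
rewrite (joint_law_formula nCB nnmeas1).
have mZp : measurable_fun setT (fun p : Omega * U => (Z p.1, p.2)).
  by apply: measurable_fun_pair => //; exact: measurableT_comp.
apply: ge0_ae_eq_integral => //.
- by apply: emeasurable_funM; [exact: (measurableT_comp nC.2 mZp)
                              |exact: (measurableT_comp mN mZp)].
- by apply: emeasurable_funM; [exact: (measurableT_comp nCB.2 mZp)
                              |exact: (measurableT_comp mD mZp)].
- by move=> p _; rewrite mule_ge0// lee_fin.
- by move=> p _; rewrite mule_ge0//; exact: nCB.1.
apply: filterS (weighted_integral_ae_lty nnmeas1 integral_probability1) => p Doo _.
rewrite -muleA; congr (_ * _); rewrite /nB' -muleA.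
set v := (Z p.1, p.2) in Doo *.
rewrite -[in X in _ = _ * (_ * X)](@fineK _ (D v)) ?ge0_fin_numE// -EFinM.
have [Dv|Dv] := eqVneq (D v) 0; last first.
  rewrite mulVf ?mule1//; apply: contra Dv => /eqP Dv.
  by rewrite -(@fineK _ (D v)) ?ge0_fin_numE// Dv.
rewrite Dv /= mulr0 mule0; apply/eqP; rewrite eq_le N0 andbT -[leRHS]Dv.
apply: ge0_le_integral => //.
- by move=> y _; rewrite mule_ge0// lee_fin// joint_weight_ge0.
- apply: emeasurable_funM; first exact: nB.2.
  apply/measurable_EFinP/(measurableT_comp measurable_joint_weight).
  exact: pair1_measurable.
- apply: emeasurable_funM => //.
  apply/measurable_EFinP/(measurableT_comp measurable_joint_weight).
  exact: pair1_measurable.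
- move=> y _; rewrite lee_pmul// ?lee_fin ?joint_weight_ge0//.
Qed.

End bayes.

(** * The posterior mean under a Markov property *)

Section posterior_mean.
Context d (Omega : measurableType d) (R : realType) (P : probability Omega R).
Context dv (S : measurableType dv).
Variables (V : Omega -> S) (Y : Omega -> R).
Hypotheses (mV : measurable_fun setT V) (mY : measurable_fun setT Y).
Variables (k : R.-sfker S ~> measurableTypeR R).
Variable r : S * measurableTypeR R -> R.
Hypotheses (mr : measurable_fun setT r) (r0 : forall x, (0 <= r x)%R).
Hypothesis VY : disintegrates (Ty := measurableTypeR R) P setT V Y k r.
Local Notation posterior_mass B v := (\int[k v]_(y in B) (r (v, y))%:E).

Lemma measurable_posterior_mass (B : set R) : measurable B ->
  measurable_fun setT (fun v => posterior_mass B v).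
Proof.
move=> mB.
have nB : nnmeas (fun vy : S * measurableTypeR R => (\1_B vy.2 : R)%:E).
  split=> [vy|]; first by rewrite lee_fin.
  apply/measurable_EFinP.
  by apply: (measurableT_comp (measurable_indic _)) => //; exact: measurable_snd.
have [_] := nnmeas_kernel k (nnmeasM_weight mr r0 nB).
apply: eq_measurable_fun => v _; rewrite [RHS]integral_mkcond.
apply: eq_integral => y _; rewrite patchE /= indicE.
by case: (y \in B); rewrite ?mul1e ?mul0e.
Qed.

Let posterior_mass_ge0 (B : set R) v : 0 <= posterior_mass B v.
Proof. by apply: integral_ge0 => y _; rewrite lee_fin. Qed.

Let measurable_posterior_massV (B : set R) : measurable B ->
  measurable_fun setT (fun w => posterior_mass B (V w)).
Proof.
by move=> mB; exact: (measurableT_comp (measurable_posterior_mass mB) mV).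
Qed.

Let integral_fine_posterior_mass (B : set R) A : measurable B -> measurable A ->
  \int[P]_(w in A) (fine (posterior_mass B (V w)))%:E =
  \int[P]_(w in A) posterior_mass B (V w).
Proof.
move=> mB mA.
have inV : P.-integrable setT (fun w => posterior_mass B (V w)).
  apply/integrableP; split; first exact: measurable_posterior_massV.
  under eq_integral do rewrite gee0_abs//.
  have := VY measurableT mB; rewrite setTI preimage_setT => <-.
  rewrite (le_lt_trans (probability_le1 _ _)) ?ltry//; apply: measurableI => //.
  by rewrite -[X in measurable X]setTI; exact: mY.
apply: ae_eq_integral => //.
- apply/measurable_EFinP/measurable_funTS/measurableT_comp => //.
  exact: measurable_posterior_massV.
- exact/measurable_funTS/measurable_posterior_massV.
- by apply: filterS (integrable_ae measurableT inV) => w /(_ Logic.I) nw _; rewrite fineK.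
Qed.

Lemma disintegrates_cond_prob (B : set R) : measurable B ->
  is_cond_prob P (sigma_of V) (Y @^-1` B) (fun w => fine (posterior_mass B (V w))).
Proof.
move=> mB; have sVm := sigma_of_measurable mV.
have mYB : measurable (Y @^-1` B).
  by rewrite -[X in measurable X]setTI; exact: mY.
have intE A : sigma_of V A ->
    \int[P]_(w in A) (fine (posterior_mass B (V w)))%:E = P (A `&` Y @^-1` B).
  move=> sA; rewrite integral_fine_posterior_mass//; last exact: sVm.
  by have /sigma_ofP[C mC ->] := sA; have := VY mC mB; rewrite setTI => <-.
split.
- move=> E mE; apply: (sigma_of_comp V (f := fun v => fine (posterior_mass B v))) => //.
  by apply: measurableT_comp => //; exact: measurable_posterior_mass.
- apply/integrableP; split.
    apply/measurable_EFinP/measurableT_comp => //.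
    exact: measurable_posterior_massV.
  rewrite (eq_integral (fun w => (fine (posterior_mass B (V w)))%:E)); last first.
    by move=> w _; rewrite /= ger0_norm// fine_ge0.
  rewrite intE ?(le_lt_trans (probability_le1 _ _)) ?ltry//.
    exact: measurableI.
  by apply/sigma_ofP; exists setT.
- move=> A sA; rewrite intE// integral_indic//; last exact: sVm.
  by rewrite setIC.
Qed.

Variable G : set (set Omega).
Hypotheses (sG : sigma_algebra setT G) (Gm : G `<=` measurable).
Hypothesis VG : sigma_of V `<=` G.
Hypothesis markov : forall B : set R, measurable B -> exists Zb : Omega -> R,
  is_cond_prob P G (Y @^-1` B) Zb /\
  is_cond_prob P (sigma_of V) (Y @^-1` B) Zb.

Lemma sub_sigma_algebraI A B : G A -> G B -> G (A `&` B).
Proof.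
rewrite -(sigma_algebra_id sG) => GA GB.
by have := @measurableI _ (g_sigma_algebraType G) A B GA GB.
Qed.

(** Over an event of the form [A `&` V @^-1` C] with [A] in [G], the Markov
    property provides a version of the conditional probability of
    [Y @^-1` B] given [G] that is also a version given [V]; the latter is the
    posterior mass of [B]. *)
Lemma markov_disintegrates A : G A ->
  disintegrates (Ty := measurableTypeR R) P A V Y k r.
Proof.
move=> GA C B mC mB; have sVm := sigma_of_measurable mV.
have mYB : measurable (Y @^-1` B).
  by rewrite -[X in measurable X]setTI; exact: mY.
have [Zb [hG hV]] := markov mB.
have Zz := cond_exp_unique (sigma_algebra_sigma_of V) sVm hV
  (disintegrates_cond_prob mB).
have GAC : G (A `&` V @^-1` C).
  by apply: sub_sigma_algebraI => //; apply: VG; apply/sigma_ofP; exists C.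
have mAC := Gm GAC.
rewrite -(cond_prob_integral mYB Gm hG GAC) -integral_fine_posterior_mass//.
apply: ae_eq_integral => //.
- have [_ iZ _] := hG; exact: measurable_funTS (measurable_int _ iZ).
- apply/measurable_EFinP/measurable_funTS/measurableT_comp => //.
  exact: measurable_posterior_massV.
- by apply: filterS Zz => w ->.
Qed.

Hypothesis iY : P.-integrable setT (EFin \o Y).

Definition posterior_mean (w : Omega) : R := (\int[k (V w)]_y (y * r (V w, y)))%R.

(* [part 1] and [part (-1)] are the positive and the negative part, for which
   [disintegratesE] is available. *)
Let part (s : R) (y : R) : \bar R := (Num.max (s * y) 0)%:E.

Let nnmeas_part s : nnmeas (fun vy : S * measurableTypeR R => part s vy.2).
Proof.
split=> [vy|]; first by rewrite lee_fin le_max lexx orbT.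
apply/measurable_EFinP/measurable_maxr => //; exact: measurable_funM.
Qed.

Let Npart s v := \int[k v]_y (part s y * (r (v, y))%:E).

Let nnmeas_Npart s : nnmeas (Npart s).
Proof. exact: (nnmeas_kernel k (nnmeasM_weight mr r0 (nnmeas_part s))). Qed.

Let NpartE s A : G A ->
  \int[P]_(w in A) part s (Y w) = \int[P]_(w in A) Npart s (V w).
Proof.
move=> GA.
have mY' : measurable_fun setT (Y : Omega -> measurableTypeR R) by [].
exact: (disintegratesE (Gm GA) mV mY' mr r0 (markov_disintegrates GA)
  (nnmeas_part s)).
Qed.

Let GT : G setT.
Proof. by case: sG => G0 GC _; rewrite -[setT](@setD0 _ setT); exact: GC. Qed.

Let iNpart s : s \in [:: 1%R; (-1)%R] -> P.-integrable setT (fun w => Npart s (V w)).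
Proof.
move=> s1; have [N0 mN] := nnmeas_Npart s; apply/integrableP; split.
  exact: measurableT_comp.
under eq_integral do rewrite gee0_abs//.
rewrite -NpartE//; have /integrableP[_] := iY; apply: le_lt_trans.
apply: ge0_le_integral => //.
- by move=> w _; rewrite lee_fin le_max lexx orbT.
- apply/measurable_EFinP/measurable_maxr => //; exact: measurable_funM.
- by apply: measurableT_comp => //; exact/measurable_EFinP.
- move=> w _; rewrite /= lee_fin ge_max normr_ge0 andbT.
  move: s1; rewrite !inE => /orP[/eqP->|/eqP->]; rewrite ?mul1r ?ler_norm//.
  by rewrite mulN1r -normrN ler_norm.
Qed.

Let posterior_integral_parts v : \int[k v]_y (y * r (v, y))%:E = Npart 1 v - Npart (-1) v.
Proof.
rewrite integralE; congr (_ - _); apply: eq_integral => y _.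
- rewrite funeposE /part mul1r -EFinM -EFin_max; congr EFin.
  by rewrite maxr_pMl// mul0r.
- rewrite funenegE /part mulN1r -EFinM -EFinN -EFin_max; congr EFin.
  by rewrite maxr_pMl// mul0r mulNr.
Qed.

(** The disintegration identity on the events of [G], applied to the positive
    and to the negative part of [Y].  Integrability of [Y] makes both posterior
    integrals almost surely finite, so that their difference is the
    real-valued posterior mean. *)
Lemma is_cond_exp_posterior_mean : is_cond_exp P G Y posterior_mean.
Proof.
have [N10 mN1] := nnmeas_Npart 1; have [N20 mN2] := nnmeas_Npart (-1).
have i1 : P.-integrable setT (fun w => Npart 1 (V w)).
  by apply: iNpart; rewrite !inE eqxx.
have i2 : P.-integrable setT (fun w => Npart (-1) (V w)).
  by apply: iNpart; rewrite !inE eqxx orbT.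
have pmE : posterior_mean = (fun v => fine (Npart 1 v - Npart (-1) v)) \o V.
  by apply/funext => w; rewrite /posterior_mean /Rintegral posterior_integral_parts.
have mpm : measurable_fun setT (fun v => fine (Npart 1 v - Npart (-1) v)).
  by apply: measurableT_comp => //; exact: emeasurable_funB.
have aefin : {ae P, forall w, (posterior_mean w)%:E =
    Npart 1 (V w) - Npart (-1) (V w)}.
  move: (integrable_ae measurableT i1) (integrable_ae measurableT i2).
  apply: filterS2 => w /(_ Logic.I) f1 /(_ Logic.I) f2.
  by rewrite pmE /= fineK// fin_numB f1 f2.
have mpV : measurable_fun setT (EFin \o posterior_mean).
  by rewrite pmE; apply/measurable_EFinP; exact: measurableT_comp.
have i12 := integrableB measurableT i1 i2.
have ipm : P.-integrable setT (EFin \o posterior_mean).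
  have /integrableP[_ lt12] := i12.
  apply/integrableP; split => //; apply: le_lt_trans lt12.
  rewrite le_eqVlt; apply/orP; left; apply/eqP.
  apply: ge0_ae_eq_integral => //.
  - exact: measurableT_comp.
  - by apply: measurableT_comp => //; exact: measurable_int i12.
  - by apply: filterS aefin => w h _; exact: (congr1 abse h).
split => //.
  by move=> B mB; apply: VG; rewrite pmE; exact: sigma_of_comp.
move=> A GA; have mA := Gm GA.
transitivity (\int[P]_(w in A) (Npart 1 (V w) - Npart (-1) (V w))).
  apply: ae_eq_integral => //.
  - exact: measurable_funTS.
  - exact: measurable_funTS (measurable_int _ i12).
  - by apply: filterS aefin.
rewrite integralB//; [|exact: integrableS i1|exact: integrableS i2].
rewrite -!NpartE// [RHS]integralE; congr (_ - _); apply: eq_integral => w _.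
- by rewrite /part mul1r funeposE -EFin_max.
- by rewrite /part mulN1r funenegE -EFinN -EFin_max.
Qed.

Lemma posterior_mean_ae (M : Omega -> R) : is_cond_exp P G Y M ->
  {ae P, forall w, M w = posterior_mean w}.
Proof.
by move=> hM; exact: (cond_exp_unique sG Gm hM is_cond_exp_posterior_mean).
Qed.

End posterior_mean.

(** * The ratio formula for a prior given by a kernel *)

Section bayes_mean.
Context d (Omega : measurableType d) (R : realType) (P : probability Omega R).
Context ds (S : measurableType ds) du (U : measurableType du).
Variable nu : {sigma_finite_measure set U -> \bar R}.
Variables (Z : Omega -> S) (Y : Omega -> R) (V : Omega -> U).
Hypotheses (mZ : measurable_fun setT Z) (mY : measurable_fun setT Y).
Hypothesis mV : measurable_fun setT V.
Variables (k : R.-sfker S ~> measurableTypeR R).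
Variables (rho : S * measurableTypeR R -> R).
Variables (h : S * measurableTypeR R * U -> R).
Hypotheses (mrho : measurable_fun setT rho) (rho0 : forall x, (0 <= rho x)%R).
Hypotheses (mh : measurable_fun setT h) (h0 : forall x, (0 <= h x)%R).
Hypothesis HY : disintegrates (Ty := measurableTypeR R) P setT Z Y k rho.
Hypothesis HV : disintegrates (S := (S * measurableTypeR R)%type)
  P setT (fun w => (Z w, Y w)) V (kcst nu) h.
Variable G : set (set Omega).
Hypotheses (sG : sigma_algebra setT G) (Gm : G `<=` measurable).
Hypothesis VG : sigma_of (fun w => (Z w, V w)) `<=` G.
Hypothesis markov : forall B : set R, measurable B -> exists Zb : Omega -> R,
  is_cond_prob P G (Y @^-1` B) Zb /\
  is_cond_prob P (sigma_of (fun w => (Z w, V w))) (Y @^-1` B) Zb.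
Hypothesis iY : P.-integrable setT (EFin \o Y).
Variable M : Omega -> R.
Hypothesis hM : is_cond_exp P G Y M.

Let q w y := (h (Z w, y, V w) * rho (Z w, y))%R.

(** [posterior_mean_ae] with the weight [q] divided by its integral.  The two
    integrability claims say that the unnormalised posterior integrals of 1 and
    of [`|y|] are almost surely finite. *)
Theorem bayes_mean : {ae P, forall w,
  [/\ (k (Z w)).-integrable setT (fun y => (y * q w y)%:E),
      (k (Z w)).-integrable setT (fun y => (q w y)%:E),
      (0 < \int[k (Z w)]_y (q w y))%R &
      M w = (\int[k (Z w)]_y (y * q w y) / \int[k (Z w)]_y (q w y))%R]}.
Proof.
have mY' : measurable_fun setT (Y : Omega -> measurableTypeR R) by [].
have mZV := measurable_fun_pair mZ mV.
have mjw w : measurable_fun setT (q w : measurableTypeR R -> R).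
  apply: (measurableT_comp (measurable_joint_weight mrho mh)
    (pair1_measurable (Z w, V w))).
have mYq w : measurable_fun setT (fun y : measurableTypeR R => (y * q w y)%R).
  by apply: measurable_funM => //; exact: measurable_id.
have nabs : nnmeas (fun y : measurableTypeR R => `|y%:E| : \bar R).
  split=> [y|]; first by rewrite abse_ge0.
  by apply: measurableT_comp => //; apply/measurable_EFinP; exact: measurable_id.
have absoo : \int[P]_w `|(Y w)%:E| < +oo by have /integrableP[] := iY.
have mpw := measurable_posterior_weight k mrho rho0 mh h0.
have aeM := posterior_mean_ae mZV mY mpw
  (posterior_weight_ge0 k mrho rho0 mh h0)
  (posterior_disintegrates mZ mY' mV mrho rho0 mh h0 HY HV) sG Gm VG markov iY hM.
have aeD0 := joint_marginal_gt0 mZ mY' mV mrho rho0 mh h0 HY HV.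
have aeD := joint_weighted_integral_lty mZ mY' mV mrho rho0 mh h0 HY HV
  (nnmeas1 R _) (integral_probability1 P).
have aeN := joint_weighted_integral_lty mZ mY' mV mrho rho0 mh h0 HY HV
  nabs absoo.
have aeDN : {ae P, forall w,
    weighted_integral k rho h (fun=> 1) (Z w, V w) < +oo /\
    weighted_integral k rho h (fun y => `|y%:E|) (Z w, V w) < +oo}.
  by move: aeD aeN; apply: filterS2.
move: aeM aeD0 aeDN; apply: filterS3 => w Mw D0 [Doo Noo].
have DE : weighted_integral k rho h (fun=> 1) (Z w, V w) =
    \int[k (Z w)]_y (q w y)%:E.
  by apply: eq_integral => y _; rewrite mul1e.
rewrite DE in D0 Doo.
have i2 : (k (Z w)).-integrable setT (fun y => (q w y)%:E).
  apply/integrableP; split; first exact/measurable_EFinP.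
  rewrite (eq_integral (fun y => (q w y)%:E))// => y _.
  by rewrite gee0_abs// lee_fin mulr_ge0.
have i1 : (k (Z w)).-integrable setT (fun y => (y * q w y)%:E).
  apply/integrableP; split; first exact/measurable_EFinP.
  apply: le_lt_trans Noo; rewrite le_eqVlt; apply/orP; left; apply/eqP.
  apply: eq_integral => y _; rewrite /= normrM EFinM; congr (_ * _%:E).
  by rewrite ger0_norm// mulr_ge0.
have ID0 : (0 < \int[k (Z w)]_y (q w y))%R by rewrite fine_gt0// D0.
split => //; rewrite Mw /posterior_mean -RintegralZr//.
apply: eq_Rintegral => y _ /=; rewrite mulrA; congr (_ / _)%R.
by rewrite DE.
Qed.

End bayes_mean.

(** * Weights that depend on the sample point; distribution functions *)

(** A prior presented by versions of conditional probabilities, such as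
    [F (Z w) y] or [q y w], is known to be measurable only as a function of the
    sample point [w], with respect to sigma([Z]): the map [z |-> F z y] itself
    need not be measurable.  Therefore the role of [Z] in [bayes_mean] is played
    by the identity map from Omega to Omega with the sigma-algebra sigma([Z]);
    the two variables generate the same sigma-algebra. *)
Section bayes_mean_given.
Context d (Omega : measurableType d) (R : realType) (P : probability Omega R).
Context ds (S : measurableType ds).
Variable Z : Omega -> S.
Hypothesis mZ : measurable_fun setT Z.

Local Notation OmegaZ := (g_sigma_algebra_preimageType Z).

Definition given (w : Omega) : OmegaZ := w.

Lemma measurable_given : measurable_fun setT given.
Proof. by move=> _ A [C mC <-]; rewrite !setTI; rewrite -[X in measurable X]setTI; exact: mZ. Qed.

Lemma sigma_of_given_pair du (U : measurableType du) (V : Omega -> U) :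
  sigma_of (fun w => (given w, V w)) = sigma_of (fun w => (Z w, V w)).
Proof.
pose ZV w := (Z w, V w).
have mV : measurable_fun setT (V : g_sigma_algebra_preimageType ZV -> U).
  move=> _ A mA; exists (setT `*` A); first exact: measurableX.
  by rewrite !setTI; apply/seteqP; split => [w []|w Aw] //=.
have mg : measurable_fun setT (given : g_sigma_algebra_preimageType ZV -> OmegaZ).
  move=> _ _ [C mC <-]; exists (C `*` setT); first exact: measurableX.
  by rewrite !setTI; apply/seteqP; split => [w []|w Cw] //=.
apply/seteqP; split=> [_ [C mC <-]|_ [C mC <-]].
  exact: (measurable_fun_pair mg mV measurableT mC).
have mZ' : measurable_fun setT (Z : OmegaZ -> S).
  by move=> _ A mA; exists A.
exists ((fun p : OmegaZ * U => (Z p.1, p.2)) @^-1` C) => //.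
rewrite -[X in measurable X]setTI.
have : measurable_fun setT (fun p : OmegaZ * U => (Z p.1, p.2)).
  apply: measurable_fun_pair => //.
  exact: (measurableT_comp mZ' measurable_fst).
by apply.
Qed.

Variables (Y V : Omega -> R).
Hypotheses (mY : measurable_fun setT Y) (mV : measurable_fun setT V).
Variable h : S * R -> R -> R.
Hypothesis hh : is_cond_density P (fun w => (Z w, Y w)) V h.
Variables (k : R.-sfker OmegaZ ~> measurableTypeR R).
Variable rho : OmegaZ * measurableTypeR R -> R.
Hypotheses (mrho : measurable_fun setT rho) (rho0 : forall x, (0 <= rho x)%R).
Hypothesis HY : forall A B, sigma_of Z A -> measurable B ->
  P (A `&` Y @^-1` B) = \int[P]_(w in A) \int[k w]_(y in B) (rho (w, y))%:E.
Variable G : set (set Omega).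
Hypotheses (sG : sigma_algebra setT G) (Gm : G `<=` measurable).
Hypothesis VG : sigma_of (fun w => (Z w, V w)) `<=` G.
Hypothesis markov : forall B : set R, measurable B -> exists Zb : Omega -> R,
  is_cond_prob P G (Y @^-1` B) Zb /\
  is_cond_prob P (sigma_of (fun w => (Z w, V w))) (Y @^-1` B) Zb.
Hypothesis iY : P.-integrable setT (EFin \o Y).
Variable M : Omega -> R.
Hypothesis hM : is_cond_exp P G Y M.

Let q (w : Omega) (y : R) := (h (Z w, y) (V w) * rho (w, y))%R.

(** The likelihood does depend on [w] only through the measurable map [Z], so it
    pulls back to [OmegaZ]. *)
Theorem bayes_mean_given : {ae P, forall w : Omega,
  [/\ (k w).-integrable setT (fun y => (y * q w y)%:E),
      (k w).-integrable setT (fun y => (q w y)%:E),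
      (0 < \int[k w]_y (q w y))%R &
      M w = (\int[k w]_y (y * q w y) / \int[k w]_y (q w y))%R]}.
Proof.
have [mh h0 _] := hh.
have mZ' : measurable_fun setT (Z : OmegaZ -> S) by move=> _ A mA; exists A.
pose h' (x : OmegaZ * measurableTypeR R * measurableTypeR R) :=
  h (Z x.1.1, x.1.2) x.2.
have mh' : measurable_fun setT h'.
  apply: (measurableT_comp (f := fun zy : (S * R) * R => h zy.1 zy.2)
    (g := fun x : OmegaZ * measurableTypeR R * measurableTypeR R =>
       ((Z x.1.1, x.1.2 : R), x.2 : R)) mh).
  apply: measurable_fun_pair; last exact: measurable_snd.
  apply: measurable_fun_pair; last exact: (measurableT_comp measurable_snd measurable_fst).
  exact: (measurableT_comp mZ' (measurableT_comp measurable_fst measurable_fst)).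
have HY' : disintegrates (Ty := measurableTypeR R) P setT given Y k rho.
  by move=> C B mC mB; rewrite setTI; exact: (HY mC mB).
have HV' : disintegrates (S := (OmegaZ * measurableTypeR R)%type)
    (Ty := measurableTypeR R) P setT
    (fun w => (given w, Y w)) V (kcst lebesgue_measure) h'.
  move=> C B mC mB; rewrite setTI.
  have : sigma_of (fun w => (Z w, Y w)) ((fun w => (given w, Y w)) @^-1` C).
    by rewrite -sigma_of_given_pair; apply/sigma_ofP; exists C.
  move=> /sigma_ofP[C' mC' ->].
  have := cond_density_disintegrates (measurable_fun_pair mZ mY) mV hh mC' mB.
  by rewrite setTI.
have h0' x : (0 <= h' x)%R by exact: h0.
have mV' : measurable_fun setT (V : Omega -> measurableTypeR R) by exact: mV.
have VG' : sigma_of (fun w => (given w, (V : Omega -> measurableTypeR R) w)) `<=` G.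
  by rewrite sigma_of_given_pair.
have markov' : forall B : set R, measurable B -> exists Zb : Omega -> R,
    is_cond_prob P G (Y @^-1` B) Zb /\
    is_cond_prob P (sigma_of (fun w => (given w, (V : Omega -> measurableTypeR R) w)))
      (Y @^-1` B) Zb.
  by rewrite sigma_of_given_pair.
have H := @bayes_mean d Omega R P _ OmegaZ _ (measurableTypeR R)
  lebesgue_measure given Y V measurable_given mY mV' k rho h' mrho rho0 mh' h0' HY'.
have H2 := H HV'.
exact: (H2 G sG Gm VG' markov' iY M hM).
Qed.

End bayes_mean_given.

Section cdf_kernel.
Context d (X : measurableType d) (R : realType).
Variable F : X -> cumulativeBounded (0 : R) (1 : R).
Hypothesis mF : forall y, measurable_fun setT (fun x => F x y).

(** The kernel structure below depends on the measurability of [F], which for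
    this reason is an argument. *)
Definition kcdf of forall y, measurable_fun setT (fun x => F x y) :=
  fun x => lebesgue_stieltjes_measure (F x) :
    {measure set (measurableTypeR R) -> \bar R}.

Lemma kcdf_itv a b x : (a <= b)%R ->
  kcdf mF x `]a, b]%classic = (F x b)%:E - (F x a)%:E.
Proof.
move=> ab; have -> : kcdf mF x `]a, b]%classic =
  lebesgue_stieltjes_measure (F x) `]a, b]%classic by [].
rewrite /lebesgue_stieltjes_measure /measure_extension/= measurable_mu_extE/=.
  by rewrite wlength_itv_bnd.
exact: is_ocitv.
Qed.

Let kcdf_setT x : kcdf mF x [set: measurableTypeR R] = 1.
Proof. exact: (probability_setT (lebesgue_stieltjes_measure (F x) : probability _ R)). Qed.

(* The half-open intervals form a generating pi-system on which the measures
   are differences of values of [F]. *)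
Let kcdf_measurable U : measurable U -> measurable_fun setT (kcdf mF ^~ U).
Proof.
move: U; apply: (dynkin_induction (T := measurableTypeR R) (G := @ocitv R)) => //.
- exact: (@measurableI _ (ocitv_type R)).
- by under eq_fun do rewrite kcdf_setT; exact: measurable_cst.
- move=> _ [[a b] /= _ <-]; have [ab|ba] := leP a b.
    under eq_fun do rewrite kcdf_itv//.
    by apply: emeasurable_funB; exact/measurable_EFinP.
  rewrite set_itv_ge; last by rewrite bnd_simp -leNgt ltW.
  by under eq_fun do rewrite measure0; exact: measurable_cst.
- move=> U mU mkU; have -> : kcdf mF ^~ (~` U) = fun x => 1 - kcdf mF x U.
    apply/funext => x; rewrite -setTD measureD ?setTI//.
      by congr (_ - _); exact: kcdf_setT.
    by apply: le_lt_trans (ltry 1); rewrite -(kcdf_setT x).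
  by apply: emeasurable_funB => //; exact: measurable_cst.
- move=> E mE tE mkE; have -> : kcdf mF ^~ (\bigcup_k E k) =
      fun x => \sum_(i <oo) kcdf mF x (E i).
    apply/funext => x; rewrite measure_bigcup//.
    by apply: eq_eseriesl => i; rewrite in_setT.
  exact: ge0_emeasurable_sum.
Qed.

HB.instance Definition _ := isKernel.Build _ _ _ _ _ (kcdf mF) kcdf_measurable.
HB.instance Definition _ := Kernel_isProbability.Build _ _ _ _ _ (kcdf mF) kcdf_setT.

End cdf_kernel.

Section cdf_disintegrates.
Context d (Omega : measurableType d) (R : realType) (P : probability Omega R).
Context ds (S : measurableType ds).
Variables (Z : Omega -> S) (Y : Omega -> R).
Hypotheses (mZ : measurable_fun setT Z) (mY : measurable_fun setT Y).
Variable F : S -> cumulativeBounded (0 : R) (1 : R).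
Hypothesis hF : is_cond_cdf P Z Y F.

Local Notation OmegaZ := (g_sigma_algebra_preimageType Z).

Lemma measurable_cond_cdf y : measurable_fun setT (fun w : OmegaZ => F (Z w) y).
Proof. by move=> _ B mB; rewrite setTI; case: (hF y) => + _ _; exact. Qed.

(** For [B = `]a, b]] this is the difference of the defining identities at [b]
    and at [a]; half-open intervals form a generating pi-system. *)
Lemma cond_cdf_disintegrates A B : sigma_of Z A -> measurable B ->
  P (A `&` Y @^-1` B) = \int[P]_(w in A) kcdf measurable_cond_cdf w B.
Proof.
move=> sA; have sZm := sigma_of_measurable mZ; have mA := sZm _ sA.
have mYB (C : set R) : measurable C -> measurable (A `&` Y @^-1` C).
  by move=> mC; apply: measurableI => //; rewrite -[X in measurable X]setTI; exact: mY.
have kE w C : kcdf measurable_cond_cdf w C = lebesgue_stieltjes_measure (F (Z w)) C by [].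
have mk (C : set R) : measurable C ->
    measurable_fun A (fun w => kcdf measurable_cond_cdf w C).
  move=> mC; apply: measurable_funTS.
  exact: (measurableT_comp (measurable_kernel (kcdf measurable_cond_cdf) C mC)
    (measurable_given mZ)).
move: B; apply: (dynkin_induction (T := measurableTypeR R) (G := @ocitv R)) => //.
- exact: (@measurableI _ (ocitv_type R)).
- rewrite preimage_setT setIT; under eq_integral do rewrite prob_kernel.
  by rewrite integral_cst// mul1e.
- move=> _ [[a b] /= _ <-]; have [ab|ba] := leP a b; last first.
    rewrite set_itv_ge; last by rewrite bnd_simp -leNgt ltW.
    rewrite preimage_set0 setI0 measure0; apply/esym/integral0_eq => w _.
    by rewrite measure0.
  have Fint y : P.-integrable A (fun w => (F (Z w) y)%:E).
    by case: (hF y) => _ iF _; exact: integrableS iF.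
  transitivity (\int[P]_(w in A) ((F (Z w) b)%:E - (F (Z w) a)%:E)); last first.
    by apply: eq_integral => w _; exact/esym/(kcdf_itv measurable_cond_cdf).
  rewrite integralB//.
  have mNy (y : R) : measurable (Y @^-1` `]-oo, y]).
    by rewrite -[X in measurable X]setTI; exact: mY.
  rewrite !(cond_prob_integral (mNy _) sZm (hF _) sA).
  have -> : `]a, b]%classic = `]-oo, b] `\` `]-oo, a].
    by rewrite -[RHS]setCK setCD setCitvl setUC -[LHS]setCK setCitv.
  rewrite (_ : A `&` _ = (A `&` Y @^-1` `]-oo, b]) `\`
      (A `&` Y @^-1` `]-oo, a])).
    rewrite measureD; [|exact: measurableI..|]; last first.
      by rewrite (le_lt_trans (probability_le1 _ _)) ?ltry//; exact: measurableI.
    congr (_ - P _); apply/setIidr => w /= [Aw Ya]; split => //.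
    move: Ya; rewrite !in_itv /= => Ya; exact: le_trans Ya ab.
  apply/seteqP; split => w /=.
    by move=> [Aw [Yb Ya]]; split => // -[_]; exact: Ya.
  by move=> [[Aw ?] na]; split => //; split => // Ya; apply: na; split.
- move=> U mU IU.
  transitivity (\int[P]_(w in A) (1 - kcdf measurable_cond_cdf w U)); last first.
    apply: eq_integral => w _; rewrite -[in RHS]setTD measureD ?setTI//.
      by congr (_ - _); exact/esym/prob_kernel.
    apply: (@le_lt_trans _ _ 1); last exact: ltry.
    by rewrite le_eqVlt; apply/orP; left; apply/eqP; exact: prob_kernel.
  have kU : P.-integrable A (fun w => kcdf measurable_cond_cdf w U).
    apply/integrableP; split; first exact: mk.
    under eq_integral do rewrite gee0_abs//.
    by rewrite -IU (le_lt_trans (probability_le1 _ _)) ?ltry//; exact: mYB.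
  rewrite integralB//; last exact: finite_measure_integrable_cst.
  rewrite -IU integral_cst// mul1e.
  rewrite (_ : A `&` Y @^-1` (~` U) = A `\` (A `&` Y @^-1` U)).
    rewrite measureD//; [|exact: mYB|]; last first.
      by rewrite (le_lt_trans (probability_le1 _ _)) ?ltry.
    by congr (_ - P _); apply/setIidr => w [].
  apply/seteqP; split => w /=.
    by move=> [Aw nU]; split => // -[_]; exact: nU.
  by move=> [Aw nU]; split => // Uw; apply: nU; split.
- move=> E mE tE IE; rewrite preimage_bigcup setI_bigcupr measure_bigcup//=.
  + rewrite (eq_eseriesl _ (Q := xpredT)); last by move=> i; rewrite in_setT.
    transitivity (\int[P]_(w in A) \sum_(i <oo) kcdf measurable_cond_cdf w (E i)).
      rewrite integral_nneseries//; last by move=> n; exact: (mk _ (mE n)).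
      by apply: eq_eseriesr => i _; rewrite IE.
    apply: eq_integral => w _; rewrite measure_bigcup//.
    by apply: eq_eseriesl => i; rewrite in_setT.
  + by move=> i _; exact: (mYB _ (mE i)).
  + apply/trivIsetP => i j _ _ ij; rewrite setIACA setIid -preimage_setI.
    move/trivIsetP : tE => /(_ i j Logic.I Logic.I ij) ->.
    by rewrite preimage_set0 setI0.
Qed.

End cdf_disintegrates.

(** * Point masses *)

(** An injective index presents [D] as a disjoint union of slices with at most
    one point each.  As a series of Dirac measures over the slices, the counting
    kernel is s-finite by construction. *)
Section counting_kernel.
Context d (X : measurableType d) (R : realType).
Variables (D : set R) (idx : R -> nat).
Hypothesis idx_inj : {in D &, injective idx}.
Local Notation T := (measurableTypeR R).

Definition slice n : set R := D `&` idx @^-1` [set n].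

Definition slice_measure n : {sfinite_measure set T -> \bar R} :=
  match pselect (exists y, slice n y) with
  | left ex => dirac (sval (cid ex) : T)
  | right _ => mzero
  end.

Definition kcount : X -> {measure set T -> \bar R} :=
  kseries (fun n => kcst (slice_measure n)).

HB.instance Definition _ := SFiniteKernel.on kcount.

Lemma slice_set1 n y : slice n y -> slice n = [set y].
Proof.
move=> Dy; apply/seteqP; split => [z Dz|z ->//].
by apply: idx_inj; rewrite ?inE; [exact: Dz.1|exact: Dy.1|rewrite Dz.2 Dy.2].
Qed.

Lemma slice_cases n : slice n = set0 \/ exists y, slice n = [set y].
Proof.
have [->|/set0P[y Dy]] := eqVneq (slice n) set0; first by left.
by right; exists y; exact: slice_set1.
Qed.

Lemma measurable_slice n : measurable (slice n).
Proof. by have [->|[y ->]] := slice_cases n. Qed.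

Lemma bigcup_slice : \bigcup_n slice n = D.
Proof. by apply/seteqP; split => [y [n _ []//]|y Dy]; exists (idx y). Qed.

Lemma trivIset_slice : trivIset setT slice.
Proof. by move=> i j _ _ [y [[_ /= <-] [_ /= <-]]]. Qed.

Lemma measurable_countable : measurable D.
Proof.
by rewrite -bigcup_slice; apply: bigcup_measurable => n _; exact: measurable_slice.
Qed.

Lemma integral_slice_measure n (g : T -> \bar R) : (forall y, 0 <= g y) ->
  measurable_fun setT g ->
  \int[slice_measure n]_y g y = \esum_(y in slice n) g y.
Proof.
move=> g0 mg; rewrite /slice_measure; case: pselect => [ex|nex].
  rewrite integral_dirac// diracT mul1e.
  have /= := svalP (cid ex); set y := sval _ => sy.
  by rewrite (slice_set1 sy) esum_set1.
rewrite integral_measure_zero (_ : slice n = set0) ?esum_set0//.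
by rewrite -subset0 => y sy; apply: nex; exists y.
Qed.

Lemma integral_kcount x (g : T -> \bar R) : (forall y, 0 <= g y) ->
  measurable_fun setT g -> \int[kcount x]_y g y = \esum_(y in D) g y.
Proof.
move=> g0 mg; rewrite integral_kseries// -bigcup_slice.
rewrite nneseries_sum_bigcup//; last exact: trivIset_slice.
by apply: eq_eseriesr => n _; exact: integral_slice_measure.
Qed.

(** Real integrals and [rsum] are both differences of the positive and the
    negative part. *)
Lemma Rintegral_kcount x (g : R -> R) :
  (kcount x).-integrable setT (EFin \o g) ->
  summable D (EFin \o g) /\ (\int[kcount x]_y g y = rsum D g)%R.
Proof.
move=> ig; have mg := measurable_int _ ig; split.
  rewrite /summable -(integral_kcount x)//; first by have /integrableP[] := ig.
  exact: measurableT_comp.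
rewrite /Rintegral integralE fineB.
- rewrite /rsum !(integral_kcount x)//; last 2 first.
  + exact: measurable_funeneg.
  + exact: measurable_funepos.
  congr (fine _ - fine _)%R; apply: eq_esum => y _.
    by rewrite funeposE EFin_max.
  by rewrite funenegE EFin_max.
- exact: integrable_pos_fin_num.
- exact: integrable_neg_fin_num.
Qed.

End counting_kernel.

Section discrete.
Context d (Omega : measurableType d) (R : realType) (P : probability Omega R).
Context ds (S : measurableType ds).
Variables (Z : Omega -> S) (Y : Omega -> R).
Hypotheses (mZ : measurable_fun setT Z) (mY : measurable_fun setT Y).
Variables (D : set R) (idx : R -> nat).
Hypothesis idx_inj : {in D &, injective idx}.
Hypothesis YD : {ae P, forall w, D (Y w)}.
Variable q : R -> Omega -> R.
Hypothesis hq : forall y, is_cond_prob P (sigma_of Z) (Y @^-1` [set y]) (q y).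

Local Notation OmegaZ := (g_sigma_algebra_preimageType Z).
Local Notation T := (measurableTypeR R).

Lemma cond_mass_ge0 y : {ae P, forall w, (0 <= q y w)%R}.
Proof.
have [mq iq Eq] := hq y; have sZm := sigma_of_measurable mZ.
have m0 : forall B : set R, measurable B -> sigma_of Z ((cst 0%R : Omega -> R) @^-1` B).
  by move=> B mB; exact: (sigma_of_comp Z (measurable_cst (0%R : R)) mB).
have sA := sub_sigma_algebra_lt (sigma_algebra_sigma_of Z) mq m0.
have mA := sZm _ sA.
apply: (ae_le_of_integral iq _ mA); first exact: finite_measure_integrable_cst.
rewrite integral0; apply/eqP; rewrite eq_le; apply/andP; split.
  rewrite (eq_integral (fun w => - (- q y w)%:E)); last first.
    by move=> w _; rewrite -EFinN opprK.
  rewrite integral_ge0N ?oppe_le0; last first.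
    by move=> w /ltW; rewrite lee_fin oppr_ge0.
  by apply: integral_ge0 => w /ltW; rewrite lee_fin oppr_ge0.
by rewrite Eq//; apply: integral_ge0 => w _; rewrite lee_fin.
Qed.

(** The exceptional set of [cond_mass_ge0] depends on [y]; countability of [D]
    makes it uniform. *)
Lemma cond_mass_ae_ge0 : {ae P, forall w, forall y, D y -> (0 <= q y w)%R}.
Proof.
have : {ae P, forall w, forall n y, slice D idx n y -> (0 <= q y w)%R}.
  apply: ae_foralln => n; have [->|[y sy]] := slice_cases idx_inj n.
    by apply: aeW => w y.
  by apply: filterS (cond_mass_ge0 y) => w q0 z; rewrite sy => ->.
by apply: filterS => w q0 y Dy; apply: (q0 (idx y)).
Qed.

(** A version [q y] of a conditional probability is nonnegative only almost
    surely, and [q y w] need not be jointly measurable in [(w, y)].  Truncation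
    at 0 and restriction to the countable set [D] repair both. *)
Definition mass_weight (x : OmegaZ * T) : R :=
  if x.2 \in D then Num.max (q x.2 x.1) 0%R else 0%R.

Lemma mass_weight_ge0 x : (0 <= mass_weight x)%R.
Proof. by rewrite /mass_weight; case: ifP => // _; rewrite le_max lexx orbT. Qed.

Lemma measurable_cond_mass y : measurable_fun setT (q y : OmegaZ -> R).
Proof. by have [mq _ _] := hq y; move=> _ B mB; rewrite setTI; exact: mq. Qed.

Lemma measurable_mass_weight : measurable_fun setT mass_weight.
Proof.
have mD := measurable_countable idx_inj.
rewrite -(setUv (setT `*` D)); apply/measurable_funU.
- exact: measurableX.
- by apply: measurableC; exact: measurableX.
split; last first.
  apply: (eq_measurable_fun (cst (0%R : R))); last exact: measurable_cst.
  move=> x; rewrite inE => nx; rewrite /mass_weight; case: ifPn => //.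
  by rewrite inE => Dx; exfalso; apply: nx; split.
rewrite -(bigcup_slice D idx) setX_bigcupr; apply/measurable_fun_bigcup.
  by move=> n; apply: measurableX => //; exact: measurable_slice.
move=> n; have [->|[y sy]] := slice_cases idx_inj n.
  by rewrite setX0; exact: measurable_fun_set0.
have [Dy _] : slice D idx n y by rewrite sy.
rewrite sy; apply: (eq_measurable_fun (fun x : OmegaZ * T => Num.max (q y x.1) 0%R)).
  move=> x; rewrite inE => -[_ /= xy]; by rewrite /mass_weight xy mem_set.
apply: measurable_funTS; apply: measurable_maxr => //.
exact: (measurableT_comp (measurable_cond_mass y) measurable_fst).
Qed.

(** [Y] almost surely belongs to [D], so both sides are sums over the slices.
    On the slice [[set y]] the identity is the definition of [q y]. *)
Lemma cond_mass_disintegrates A B : sigma_of Z A -> measurable B ->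
  P (A `&` Y @^-1` B) = \int[P]_(w in A)
    \int[@kcount _ OmegaZ R D idx w]_(y in B) (mass_weight (w, y))%:E.
Proof.
move=> sA mB; have sZm := sigma_of_measurable mZ; have mA := sZm _ sA.
have mYB (C : set R) : measurable C -> measurable (A `&` Y @^-1` C).
  by move=> mC; apply: measurableI => //; rewrite -[X in measurable X]setTI; exact: mY.
have msl := measurable_slice idx_inj.
have mD := measurable_countable idx_inj.
pose g w (y : T) : \bar R := (mass_weight (w, y) * \1_B y)%:E.
have g0 w y : 0 <= g w y by rewrite lee_fin mulr_ge0// mass_weight_ge0.
have mg w : measurable_fun setT (g w).
  apply/measurable_EFinP/measurable_funM; last exact: measurable_indic.
  exact: (measurableT_comp measurable_mass_weight (pair1_measurable w)).
have gE w n : \esum_(y in slice D idx n) g w y =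
    \int[slice_measure D idx n]_y g w y.
  by rewrite integral_slice_measure.
transitivity (\sum_(n <oo) P (A `&` Y @^-1` (B `&` slice D idx n))).
  transitivity (P (\bigcup_n (A `&` Y @^-1` (B `&` slice D idx n)))).
    rewrite -setI_bigcupr -preimage_bigcup -setI_bigcupr bigcup_slice.
    have mBD : measurable (A `&` Y @^-1` (B `&` D)) by apply: mYB; exact: measurableI.
    rewrite -(setIT (A `&` Y @^-1` B)) -(setIT (A `&` Y @^-1` (B `&` D))).
    rewrite -!integral_indic//; last exact: mYB.
    apply: ge0_ae_eq_integral => //.
    - by apply/measurable_EFinP; apply: measurable_indic; exact: mYB.
    - by apply/measurable_EFinP; exact: measurable_indic.
    apply: filterS YD => w Dw _; rewrite !indicE; congr (_%:R%:E).
    congr nat_of_bool; apply/idP/idP; rewrite !inE.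
      by move=> [Aw Bw].
    by move=> [Aw [Bw _]].
  rewrite measure_bigcup//=.
  - by apply: eq_eseriesl => i; rewrite in_setT.
  - by move=> n _; apply: mYB; exact: measurableI.
  - apply/trivIsetP => i j _ _ ij; rewrite setIACA setIid -preimage_setI setIACA.
    have tS : trivIset setT (slice D idx) by exact: trivIset_slice.
    move/trivIsetP : tS => /(_ i j Logic.I Logic.I ij) ->.
    by rewrite setI0 preimage_set0 setI0.
rewrite [RHS](eq_integral (fun w : Omega => \sum_(n <oo) \esum_(y in slice D idx n) g w y)).
  have msum n : measurable_fun A (fun w : Omega => \esum_(y in slice D idx n) g w y).
    have [->|[y ->]] := slice_cases idx_inj n.
      by under eq_fun do rewrite esum_set0; exact: measurable_cst.
    under eq_fun do rewrite esum_set1//.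
    apply/measurable_EFinP/measurable_funM; last exact: measurable_cst.
    apply: measurable_funTS.
    exact: (measurableT_comp measurable_mass_weight
      (measurableT_comp (pair2_measurable (y : T)) (measurable_given mZ))).
  rewrite integral_nneseries//; last by move=> n w _; exact: esum_ge0.
  apply: eq_eseriesr => n _; have [->|[y sy]] := slice_cases idx_inj n.
    rewrite setI0 preimage_set0 setI0 measure0; apply/esym/integral0_eq => w _.
    by rewrite esum_set0.
  have [Dy _] : slice D idx n y by rewrite sy.
  rewrite sy; under eq_integral do rewrite esum_set1//.
  have [By|nBy] := boolP (y \in B); last first.
    rewrite (_ : B `&` [set y] = set0); last first.
      by rewrite -subset0 => z [Bz /= zy]; move: nBy; rewrite -zy notin_setE.
    rewrite preimage_set0 setI0 measure0; apply/esym/integral0_eq => w _.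
    by rewrite /g indicE (negbTE nBy) mulr0.
  rewrite (_ : B `&` [set y] = [set y]); last first.
    by apply/setIidr => z ->; rewrite inE in By.
  have mYy : measurable (Y @^-1` [set y]).
    by rewrite -[X in measurable X]setTI; exact: mY.
  rewrite -(cond_prob_integral mYy sZm (hq y) sA).
  have [_ iq _] := hq y; have miq := measurable_int _ iq.
  apply: ae_eq_integral => //.
  - exact: measurable_funTS.
  - have := msum n; rewrite sy.
    by under eq_fun do rewrite esum_set1//.
  apply: filterS (cond_mass_ge0 y) => w q0 _.
  by rewrite /g indicE By mulr1 /mass_weight /= mem_set// max_l.
move=> w _; rewrite integral_mkcond.
transitivity (\int[@kcount _ OmegaZ R D idx w]_y g w y).
  apply: eq_integral => y _; rewrite patchE /g indicE.
  by case: (y \in B); rewrite ?mulr1 ?mulr0.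
rewrite integral_kcount// -nneseries_sum_bigcup ?bigcup_slice//.
exact: trivIset_slice.
Qed.

End discrete.

(** * Linear forms in a random vector with a density *)

Lemma tnth_rcons_last (A : Type) k (v : k.-tuple A) (x : A) :
  tnth [tuple of rcons v x] ord_max = x.
Proof. by rewrite (tnth_nth x) /= nth_rcons size_tuple ltnn eqxx. Qed.

Lemma tnth_rcons_init (A : Type) k (v : k.-tuple A) (x : A) (i : 'I_k) :
  tnth [tuple of rcons v x] (widen_ord (leqnSn k) i) = tnth v i.
Proof. by rewrite !(tnth_nth x) /= nth_rcons size_tuple ltn_ord. Qed.

Section absolute_continuity.
Context {R : realType}.
Local Notation T := (measurableTypeR R).
Local Notation leb := (@lebesgue_measure R).

(** A translate of Lebesgue measure gives each half-open interval its length. *)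
Lemma lebesgue_measureD (c : R) (A : set T) : measurable A ->
  leb ((fun x => x + c)%R @^-1` A) = leb A.
Proof.
move=> mA; have mc : measurable_fun setT ((fun x => x + c)%R : T -> T).
  by apply: measurable_funD => //; exact: measurable_id.
pose mmc := isMeasurableFun.Build _ _ _ _ _ mc.
pose f : {mfun T >-> T} := HB.pack ((fun x => x + c)%R : T -> T) mmc.
apply/esym; apply: (@lebesgue_measure_unique R (pushforward leb f)) => //.
move=> _ [[a b]] _ <-.
transitivity (leb `](a - c)%R, (b - c)%R]%classic); last first.
  congr leb; apply/seteqP; split => x /=;
    by rewrite !in_itv /= ltrBlDr lerBrDr.
rewrite !lebesgue_measure_itv/= !lte_fin ltrD2r.
by case: ifPn => // _; rewrite -!EFinB opprB addrA subrK.
Qed.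

(** The last coordinate is the innermost variable of the iterated integral. *)
Lemma iter_int_eq0 k (h : k.+1.-tuple R -> \bar R) :
  (forall v : k.-tuple R, \int[leb]_x h [tuple of rcons v x] = 0) ->
  iter_int h = 0.
Proof.
elim: k h => [|k ih] h h0.
  rewrite /= -[RHS](h0 [tuple]); apply: eq_integral => x _.
  by congr h; apply/val_inj.
transitivity (\int[leb]_x iter_int (fun v => h [tuple of x :: v])); first by [].
apply: integral0_eq => x _; apply: ih => v.
rewrite -[RHS](h0 [tuple of x :: v]); apply: eq_integral => y _.
by congr h; apply/val_inj.
Qed.

(** For fixed first coordinates, the form is a translation of the last one, and
    the translate of a null set is null; so the innermost integral vanishes. *)
Lemma density_linear_form_null d (Omega : measurableType d)
    (P : probability Omega R) k (V : Omega -> k.+1.-tuple R) (c : 'I_k -> R)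
    (N : set R) :
  has_density P V -> measurable N -> leb N = 0 ->
  P [set w | N (tnth (V w) ord_max -
     \sum_(i < k) c i * tnth (V w) (widen_ord (leqnSn k) i))%R] = 0.
Proof.
move=> [p [mp p0 hp]] mN N0.
pose L (v : k.+1.-tuple R) : R := (tnth v ord_max -
     \sum_(i < k) c i * tnth v (widen_ord (leqnSn k) i))%R.
have mL : measurable_fun setT L.
  apply: measurable_funB; first exact: measurable_tnth.
  apply: measurable_sum => i; apply: measurable_funM => //.
  exact: measurable_tnth.
have mLN : measurable (L @^-1` N) by rewrite -[X in measurable X]setTI; exact: mL.
rewrite -[LHS]/(P (V @^-1` (L @^-1` N))) hp//; apply: iter_int_eq0 => v.
pose s := (\sum_(i < k) c i * tnth v i)%R.
have Lx x : L [tuple of rcons v x] = (x + - s)%R.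
  rewrite /L tnth_rcons_last; congr (_ - _)%R.
  by apply: eq_bigr => i _; rewrite tnth_rcons_init.
have mNs : measurable ((fun x => x + - s)%R @^-1` N : set T).
  rewrite -[X in measurable X]setTI.
  have mc : measurable_fun setT ((fun x => x + - s)%R : T -> T).
    by apply: measurable_funD => //; exact: measurable_id.
  exact: mc.
transitivity (\int[leb]_(x in (fun x => x + - s)%R @^-1` N) (p [tuple of rcons v x])%:E).
  rewrite [RHS]integral_mkcond; apply: eq_integral => x _.
  rewrite patchE indicE (_ : (_ \in L @^-1` N) = (x \in (fun x => x + - s)%R @^-1` N)).
    by case: (_ \in _); rewrite ?mul1r ?mul0r.
  by apply/idP/idP; rewrite !inE /= Lx.
apply: null_set_integral => //; last first.
  exact: (etrans (lebesgue_measureD (- s)%R mN) N0).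
apply/measurable_EFinP/measurable_funTS/(measurableT_comp mp).
apply/measurable_fun_tnthP => i.
have [ik|ik] := ltnP i k.
  rewrite (_ : _ \o _ = cst (nth 0%R v i)); first exact: measurable_cst.
  by apply/funext => x; rewrite /= (tnth_nth 0%R) /= nth_rcons size_tuple ik.
rewrite (_ : _ \o _ = id); first exact: measurable_id.
apply/funext => x; rewrite /= (tnth_nth 0%R) /= nth_rcons size_tuple ltnNge ik /=.
by rewrite (_ : (i : nat) == k)// eqn_leq ik -ltnS ltn_ord.
Qed.

End absolute_continuity.

(** * Existence of conditional densities *)

Section cond_density_existence.
Context d (Omega : measurableType d) (R : realType) (P : probability Omega R).
Local Notation T := (measurableTypeR R).
Local Notation leb := (@lebesgue_measure R).

Lemma disintegrates_cond_density ds (S : measurableType ds) (Z : Omega -> S)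
    (W : Omega -> R) (h : S -> R -> R) :
  measurable_fun setT Z -> measurable_fun setT W ->
  measurable_fun setT (fun zy : S * R => h zy.1 zy.2) ->
  (forall z y, (0 <= h z y)%R) ->
  disintegrates (Ty := T) P setT Z W (kcst leb) (fun zy => h zy.1 zy.2) ->
  is_cond_density P Z W h.
Proof.
move=> mZ mW mh h0 ZW; split => // B mB.
have h0' (x : S * T) : (0 <= h x.1 x.2)%R by exact: h0.
exact: (disintegrates_cond_prob mZ mW (k := kcst leb) mh h0' ZW mB).
Qed.

(** The hypothesis is that the law of [(Z, W)] is dominated by
    law(Z) x Lebesgue, expressed through sections.  A Radon-Nikodym derivative
    is then a conditional density, by Tonelli's theorem. *)
Lemma cond_density_radon_nikodym ds (S : measurableType ds) (Z : Omega -> S)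
    (W : Omega -> R) :
  measurable_fun setT Z -> measurable_fun setT W ->
  (forall E : set (S * T), measurable E ->
    {ae P, forall w, leb (xsection E (Z w)) = 0} ->
    P [set w | E (Z w, W w)] = 0) ->
  exists h, is_cond_density P Z W h.
Proof.
move=> mZ mW ac.
have mW' : measurable_fun setT (W : Omega -> T) by [].
have mZW : measurable_fun setT (fun w => (Z w, W w : T)).
  exact: measurable_fun_pair.
pose Zm : {mfun Omega >-> S} := HB.pack Z (isMeasurableFun.Build _ _ _ _ _ mZ).
pose ZWm : {mfun Omega >-> (S * T)%type} :=
  HB.pack (fun w => (Z w, W w : T)) (isMeasurableFun.Build _ _ _ _ _ mZW).
(* A product of sigma-finite measures is sigma-finite: here strips over a
   sigma-finite cover of the line suffice, the first factor being a
   probability. *)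
have sf : sigma_finite setT (distribution P Zm \x leb).
  have [F TF Foo] := sigma_finiteT leb.
  exists (fun n => setT `*` F n).
    by rewrite -setX_bigcupr -TF setXTT.
  move=> n; have [mF Fn] := Foo n; split; first exact: measurableX.
  rewrite product_measure1E//; apply: le_lt_trans Fn.
  by rewrite -[leRHS]mul1e lee_wpmul2r//; exact: probability_le1.
pose m : {sigma_finite_measure set (S * T)%type -> \bar R} :=
  HB.pack (distribution P Zm \x leb) (isSigmaFinite.Build _ _ _ _ sf)
    (isSFinite.Build _ _ _ _ (sfinite_measure_sigma_finite sf)).
have dom : distribution P ZWm `<< m.
  apply/null_content_dominatesP => E mE mE0; apply: ac => //.
  have mx : measurable_fun setT (fun z => leb (xsection E z)).
    exact: measurable_fun_xsection.
  have : \int[P]_w (leb (xsection E (Z w))) = 0.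
    by rewrite -mE0 /m /= /product_measure1 ge0_integral_distribution.
  rewrite (eq_integral (fun w => `|leb (xsection E (Z w))|)); last first.
    by move=> w _; rewrite gee0_abs.
  move/(ae_eq_integral_abs P measurableT (measurableT_comp mx mZ)).
  by apply: filterS => w /(_ Logic.I).
have [f [f0 ffin fint fE]] := radon_nikodym_sigma_finite dom.
have mf := measurable_int _ fint.
exists (fun z y => fine (f (z, y))).
apply: disintegrates_cond_density => //.
- apply: (measurableT_comp (f := fine)) => //.
  by rewrite (_ : (fun _ => _) = f)//; apply/funext => -[].
- by move=> z y; exact: fine_ge0.
move=> C B mC mB; rewrite setTI.
transitivity (\int[m]_(x in C `*` B) f x).
  by rewrite -fE//; exact: measurableX.
pose phi (x : S * T) : \bar R := f x * (\1_(C `*` B) x)%:E.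
have nphi : nnmeas phi.
  split=> [x|]; first by rewrite mule_ge0// lee_fin.
  apply: emeasurable_funM => //; apply/measurable_EFinP/measurable_indic.
  exact: measurableX.
transitivity (\int[m]_x phi x).
  rewrite integral_mkcond; apply: eq_integral => x _; rewrite patchE /phi indicE.
  by case: (x \in _); rewrite ?mule1 ?mule0.
rewrite /m fubini_tonelli1//; [|exact: nphi.2|exact: nphi.1].
have mF : measurable_fun setT (fubini_F leb phi).
  by apply: measurable_fun_fubini_tonelli_F; [exact: nphi.2|exact: nphi.1].
rewrite ge0_integral_distribution//; last first.
  by move=> z; apply: integral_ge0 => y _; exact: nphi.1.
rewrite [RHS]integral_mkcond; apply: eq_integral => w _ /=.
rewrite patchE /fubini_F /phi; case: ifPn => wC.
  rewrite [RHS]integral_mkcond; apply: eq_integral => y _.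
  rewrite patchE indicE (_ : ((Z w, y) \in C `*` B) = (y \in B)).
    by case: (y \in B); rewrite ?mule1 ?mule0// fineK.
  apply/idP/idP; rewrite !inE; first by case.
  by move=> yB; split => //; move: wC; rewrite inE.
apply: integral0_eq => y _; rewrite indicE (_ : _ \in _ = false) ?mule0//.
by apply/negP; rewrite inE => -[Cw _]; move/negP: wC; apply; rewrite inE.
Qed.

(** Given [X], the variable [U + gamma (X)] has the law of [U] translated by a
    constant.  It therefore gives no mass to a set whose section at [zeta (X)]
    is null, and this passes from [X] to [zeta (X)] by integration. *)
Lemma cond_density_independent_noise dk (K : measurableType dk)
    ds (S : measurableType ds) (X : Omega -> K) (zeta : K -> S)
    (gamma : K -> R) (U : Omega -> R) :
  measurable_fun setT X -> measurable_fun setT zeta ->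
  measurable_fun setT gamma -> measurable_fun setT U ->
  (forall C B, measurable C -> measurable B ->
    P (X @^-1` C `&` U @^-1` B) = P (X @^-1` C) * P (U @^-1` B)) ->
  (forall N : set R, measurable N -> leb N = 0 -> P (U @^-1` N) = 0) ->
  exists h, is_cond_density P (zeta \o X) (fun w => (U w + gamma (X w))%R) h.
Proof.
move=> mX mzeta mgamma mU indep acU.
have mgX : measurable_fun setT (fun w => gamma (X w)) by exact: measurableT_comp.
apply: cond_density_radon_nikodym; [exact: measurableT_comp|exact: measurable_funD|].
move=> E mE E0.
pose Um : {mfun Omega >-> R} := HB.pack U (isMeasurableFun.Build _ _ _ _ _ mU).
have XU : disintegrates P setT X U (kcst (distribution P Um)) (cst 1%R).
  move=> C B mC mB; rewrite setTI indep//.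
  have mXC : measurable (X @^-1` C) by rewrite -[X in measurable X]setTI; exact: mX.
  transitivity (\int[P]_(w in X @^-1` C) cst (P (U @^-1` B)) w).
    by rewrite integral_cst//= muleC.
  apply: eq_integral => w _.
  by rewrite (eq_integral (cst 1))// integral_cst// mul1e.
pose L (x : K * R) : S * T := (zeta x.1, (x.2 + gamma x.1)%R).
have mg1 : measurable_fun setT (fun x : K * R => gamma x.1).
  by apply: measurableT_comp => //; exact: measurable_fst.
have m2 : measurable_fun setT (fun x : K * R => x.2) by exact: measurable_snd.
have mL : measurable_fun setT L.
  apply: measurable_fun_pair; first exact: measurableT_comp.
  exact: (measurable_funD m2 mg1).
have mLE : measurable (L @^-1` E) by rewrite -[X in measurable X]setTI; exact: mL.
have nphi : nnmeas (fun x : K * R => (\1_(L @^-1` E) x : R)%:E).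
  exact: nnmeas_indic.
have mXU := measurable_fun_pair mX mU.
have m1 : measurable_fun setT (cst 1%R : K * R -> R) by exact: measurable_cst.
have := disintegratesE measurableT mX mU m1 (fun=> ler01) XU nphi.
rewrite (eq_integral (fun w => (\1_((fun w => (X w, U w)) @^-1` (L @^-1` E)) w)%:E))//.
rewrite integral_indic//; last by rewrite -[X in measurable X]setTI; exact: mXU.
rewrite setIT => ->.
rewrite (ge0_ae_eq_integral (g := cst 0))//; first by rewrite integral0.
- have n1 : nnmeas (fun x : K * R => (\1_(L @^-1` E) x : R)%:E * (cst 1%R x : R)%:E).
    by under eq_fun do rewrite mule1.
  exact: (measurableT_comp (nnmeas_kernel (kcst (distribution P Um)) n1).2 mX).
- by move=> w _; apply: integral_ge0 => y _; rewrite mule_ge0// lee_fin.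
apply: filterS E0 => w E0 _.
rewrite (eq_integral (fun u => (\1_((fun u => L (X w, u)) @^-1` E) u)%:E)); last first.
  by move=> u _; rewrite mule1.
have mEw : measurable ((fun u => L (X w, u)) @^-1` E).
  by rewrite -[X in measurable X]setTI; exact: (measurableT_comp mL (pair1_measurable _)).
rewrite integral_indic// setIT; apply: acU => //.
rewrite -[RHS]E0 -[RHS](lebesgue_measureD (gamma (X w))); last exact: measurable_xsection.
by congr leb; apply/seteqP; split => u /=; rewrite /xsection /= inE.
Qed.

End cond_density_existence.

(** * Arcade processes *)

Section arcade_facts.
Context (R : realType) (n : nat) (T : 'I_n.+1 -> R).
Hypothesis hT : dates T.

Lemma dates_le (i j : 'I_n.+1) : (i <= j)%N -> (T i <= T j)%R.
Proof.
rewrite leq_eqVlt => /orP[/eqP ij|ij]; first by rewrite (val_inj ij).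
by apply: ltW; exact: hT.2.
Qed.

Lemma dates_inj : injective T.
Proof.
move=> i j Tij; apply/val_inj; have [ij|ji|//] := ltngtP i j.
  by have := hT.2 _ _ ij; rewrite Tij ltxx.
by have := hT.2 _ _ ji; rewrite Tij ltxx.
Qed.

Lemma horizon_dates i : horizon T (T i).
Proof.
rewrite /horizon /= in_itv /=; apply/andP; split; first exact: dates_le.
by apply: dates_le; exact: leq_ord.
Qed.

Lemma horizon_open_arcs t : open_arcs T t -> horizon T t.
Proof.
move=> [i _]; rewrite /horizon /= !in_itv /= => /andP[Ti iT]; apply/andP; split.
  by apply: le_trans (ltW Ti); exact: dates_le.
by apply: le_trans (ltW iT) _; apply: dates_le; exact: leq_ord.
Qed.

Lemma open_arcs_neq_dates t j : open_arcs T t -> t != T j.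
Proof.
move=> [i _]; rewrite /= in_itv /= => /andP[Ti iT]; apply/eqP => tj.
have [ji|ij] := leqP j i.
  have : (T j <= T (widen_ord (leqnSn n) i))%R by exact: dates_le.
  by rewrite -tj leNgt Ti.
have : (T (lift ord0 i) <= T j)%R by exact: dates_le.
by rewrite -tj leNgt iT.
Qed.

Lemma last_date_le t (i : 'I_n.+1) : horizon T t -> (i <= last_date T t)%N ->
  (T i <= t)%R.
Proof.
rewrite /horizon /= in_itv /= => /andP[T0 _]; rewrite /last_date.
by case: arg_maxnP => //= m Tm _ im; exact: le_trans (dates_le im) Tm.
Qed.

End arcade_facts.

Section rap_facts.
Context d (Omega : measurableType d) (R : realType) (P : probability Omega R).
Context (n : nat) (T : 'I_n.+1 -> R) (t : R).
Variables (D : R -> {RV P >-> R}) (X : 'I_n.+1 -> {RV P >-> R}).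
Variables (f g : 'I_n.+1 -> R -> R).
Hypotheses (hT : dates T) (ht : horizon T t).
Hypotheses (hf : interpolating T f) (hg : interpolating T g).
Local Notation I := (rap T D X f g).

(** The interpolating coefficients cancel the driver at the dates. *)
Lemma rap_date i w : I (T i) w = X i w.
Proof.
rewrite /rap (eq_bigr (fun j => (i == j)%:R * (D (T j) w - X j w))%R); last first.
  by move=> j _; rewrite hf.2 hg.2 mulrBr [j == i]eq_sym.
rewrite (bigD1 i)//= eqxx mul1r big1 ?addr0 ?subKr//.
by move=> j; rewrite eq_sym => /negbTE ->; rewrite mul0r.
Qed.

Lemma measurable_rap u : measurable_fun setT (I u).
Proof.
apply: measurable_funB => //; apply: measurable_sum => j.
by apply: measurable_funB; apply: measurable_funM.
Qed.

Lemma past_rap : past T (fun i => I (T i)) t = past T X t.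
Proof.
apply/funext => w; apply: eq_from_tnth => j.
by rewrite !tnth_mktuple rap_date.
Qed.

Lemma measurable_past : measurable_fun setT (past T X t).
Proof.
apply/measurable_fun_tnthP => j.
by rewrite (_ : _ \o _ = X (widen_ord (ltn_ord (last_date T t)) j))//;
   apply/funext => w; rewrite /= tnth_mktuple.
Qed.

Lemma history_sub_measurable : history T I t `<=` measurable.
Proof.
apply: smallest_sub; first exact: sigma_algebra_measurable.
by move=> A [u _]; apply: sigma_of_measurable; exact: measurable_rap.
Qed.

Lemma sigma_algebra_history : sigma_algebra setT (history T I t).
Proof. exact: smallest_sigma_algebra. Qed.

Lemma sigma_past_sub_history :
  sigma_of (fun w => (past T X t w, I t w)) `<=` history T I t.
Proof.
pose S : set (set Omega) := \bigcup_(u in `[T ord0, t]%classic) sigma_of (I u).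
have mI u : `[T ord0, t]%classic u ->
    measurable_fun setT (I u : g_sigma_algebraType S -> R).
  move=> tu _ B mB; rewrite setTI; apply: sub_sigma_algebra; exists u => //.
  by apply/sigma_ofP; exists B.
have T0t : (T ord0 <= t)%R by move: ht; rewrite /horizon /= in_itv => /andP[].
have mp : measurable_fun setT (past T X t : g_sigma_algebraType S -> _).
  rewrite -past_rap; apply/measurable_fun_tnthP => j.
  rewrite (_ : _ \o _ = I (T (widen_ord (ltn_ord (last_date T t)) j))); last first.
    by apply/funext => w; rewrite /= tnth_mktuple.
  apply: mI; rewrite /= in_itv /= dates_le//=.
  by apply: last_date_le => //=; rewrite -ltnS.
have mt : measurable_fun setT (I t : g_sigma_algebraType S -> R).
  by apply: mI; rewrite /= in_itv /= T0t lexx.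
by move=> _ [C mC <-]; exact: (measurable_fun_pair mp mt measurableT mC).
Qed.

(** The Markov property at the final date, where the process equals [X_n]. *)
Lemma rap_markov : conditionally_markov T P I -> forall B : set R,
  measurable B -> exists Zb : Omega -> R,
    is_cond_prob P (history T I t) (X ord_max @^-1` B) Zb /\
    is_cond_prob P (sigma_of (fun w => (past T X t w, I t w)))
      (X ord_max @^-1` B) Zb.
Proof.
move=> hM B mB; have := hM t (T ord_max) ht (horizon_dates hT _).
have tn : (t <= T ord_max)%R by move: ht; rewrite /horizon /= in_itv => /andP[].
move=> /(_ tn B mB) [Zb [h1 h2]]; exists Zb.
have E : I (T ord_max) = X ord_max by apply/funext => w; exact: rap_date.
by rewrite E past_rap in h1 h2.
Qed.

End rap_facts.

(** * The conditional density of the arcade process *)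

Section rap_density.
Context d (Omega : measurableType d) (R : realType) (P : probability Omega R).
Context (n : nat) (T : 'I_n.+1 -> R) (t : R).
Variables (D : R -> {RV P >-> R}) (X : 'I_n.+1 -> {RV P >-> R}).
Variables (f g : 'I_n.+1 -> R -> R).
Hypotheses (hT : dates T) (ht : open_arcs T t).
Hypothesis XD : independent_of_driver T P X D.

(* The part of [I t] that comes from the driver. *)
Let noise (w : Omega) : R := (D t w - \sum_(i < n.+1) f i t * D (T i) w)%R.

Let noise_null : joint_densities T P D -> forall N : set R, measurable N ->
  lebesgue_measure N = 0 -> P (noise @^-1` N) = 0.
Proof.
move=> hD N mN N0.
(* [t] comes last, because [density_linear_form_null] singles out the last
   coordinate; the tuple has no repetition, as [t] is not a date. *)
pose u := [tuple of rcons [tuple T i | i < n.+1] t].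
have uT i : tnth u (widen_ord (leqnSn n.+1) i) = T i.
  by rewrite tnth_rcons_init tnth_mktuple.
have ut : tnth u ord_max = t by exact: tnth_rcons_last.
have uu : uniq u.
  rewrite /= rcons_uniq map_inj_uniq ?enum_uniq ?andbT; last exact: dates_inj.
  by apply/mapP => -[j _ /eqP]; apply/negP; exact: open_arcs_neq_dates.
have hu i : horizon T (tnth u i).
  have := mem_tnth i u; rewrite mem_rcons inE => /orP[/eqP ->|/mapP[j _ ->]].
    exact: horizon_open_arcs.
  exact: horizon_dates.
have := density_linear_form_null (fun i => f i t) (hD _ u uu hu) mN N0.
rewrite (_ : [set w | _] = noise @^-1` N)//.
apply: (congr1 (fun F : Omega -> R => F @^-1` N)); apply/funext => w.
rewrite /= tnth_mktuple ut; congr (_ - _)%R; apply: eq_bigr => i _.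
by rewrite tnth_mktuple uT.
Qed.

Let measurable_noise : measurable_fun setT noise.
Proof.
apply: measurable_funB => //; apply: measurable_sum => j.
exact: measurable_funM.
Qed.

Let measurable_coupling : measurable_fun setT (fun w => [tuple X i w | i < n.+1]).
Proof.
apply/measurable_fun_tnthP => j.
by rewrite (_ : _ \o _ = X j)//; apply/funext => w; rewrite /= tnth_mktuple.
Qed.

Let noise_driver (B : set R) : measurable B ->
  sigma_process (horizon T) (fun s => D s) (noise @^-1` B).
Proof.
move=> mB.
pose S : set (set Omega) := \bigcup_(s in horizon T) sigma_of (D s).
have mD s : horizon T s -> measurable_fun setT (D s : g_sigma_algebraType S -> R).
  move=> hs _ A mA; rewrite setTI; apply: sub_sigma_algebra; exists s => //.
  by apply/sigma_ofP; exists A.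
have : measurable_fun setT (noise : g_sigma_algebraType S -> R).
  apply: measurable_funB; first by apply: mD; exact: horizon_open_arcs.
  apply: measurable_sum => j; apply: measurable_funM => //.
  by apply: mD; exact: horizon_dates.
by move=> /(_ measurableT B mB); rewrite setTI.
Qed.

(** [I_t] is the independent noise plus [gamma (X)], and [(X_0, ..., X_m(t), X_n)]
    is the function [zeta] of the vector [X]. *)
Lemma rap_cond_density : joint_densities T P D ->
  exists h, is_cond_density P (fun w => (past T X t w, X ord_max w))
    (rap T D X f g t) h.
Proof.
move=> hD.
pose zeta (x : n.+1.-tuple R) :=
  ([tuple tnth x (widen_ord (ltn_ord (last_date T t)) i) | i < (last_date T t).+1],
   tnth x ord_max).
pose gamma (x : n.+1.-tuple R) := (\sum_(i < n.+1) g i t * tnth x i)%R.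
have mzeta : measurable_fun setT zeta.
  apply: measurable_fun_pair; last exact: measurable_tnth.
  apply/measurable_fun_tnthP => j.
  rewrite (_ : _ \o _ = fun x : n.+1.-tuple R => tnth x (widen_ord (ltn_ord (last_date T t)) j)).
    exact: measurable_tnth.
  by apply/funext => x; rewrite /= tnth_mktuple.
have mgamma : measurable_fun setT gamma.
  by apply: measurable_sum => j; apply: measurable_funM => //; exact: measurable_tnth.
have indep C B : measurable C -> measurable B ->
    P ((fun w => [tuple X i w | i < n.+1]) @^-1` C `&` noise @^-1` B) =
    P ((fun w => [tuple X i w | i < n.+1]) @^-1` C) * P (noise @^-1` B).
  move=> mC mB; apply: XD; last exact: noise_driver.
  by apply/sigma_ofP; exists C.
have [h hh] := cond_density_independent_noise measurable_coupling mzeta mgamma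
  measurable_noise indep (noise_null hD).
exists h.
have E1 : zeta \o (fun w => [tuple X i w | i < n.+1]) =
    fun w => (past T X t w, X ord_max w).
  apply/funext => w; rewrite /zeta /=; congr (_, _); last by rewrite tnth_mktuple.
  by apply: eq_from_tnth => j; rewrite !tnth_mktuple.
have E2 : (fun w => (noise w + gamma [tuple X i w | i < n.+1])%R) = rap T D X f g t.
  apply/funext => w; rewrite /rap /noise /gamma sumrB opprB [in RHS]addrCA addrC.
  congr (_ + _)%R; first by apply: eq_bigr => j _; rewrite tnth_mktuple.
by rewrite E1 E2 in hh.
Qed.

End rap_density.

Section discrete_atoms.
Context d (Omega : measurableType d) (R : realType) (P : probability Omega R).

(** The points of [S] of mass 0 are countably many, so [Y] almost surely avoids
    all of them. *)
Lemma countable_atoms (Y : Omega -> R) (S : set R) :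
  measurable_fun setT Y -> countable S -> {ae P, forall w, S (Y w)} ->
  exists idx : R -> nat, {in atoms P Y &, injective idx} /\
    {ae P, forall w, atoms P Y (Y w)}.
Proof.
move=> mY cS YS; have mYy y : measurable (Y @^-1` [set y]).
  by rewrite -[X in measurable X]setTI; exact: mY.
have atS : atoms P Y `<=` S.
  move=> y; rewrite /atoms /= => Py; apply: contrapT => nSy.
  suff P0 : P (Y @^-1` [set y]) = 0 by rewrite P0 ltxx in Py.
  apply/negligibleP => //; apply: negligibleS YS => w /= Yw.
  by rewrite Yw.
have /countable_injP[idx idx_inj] := cS.
exists idx; split.
  by move=> x y; rewrite !inE => ax ay; apply: idx_inj; rewrite inE; exact: atS.
have : {ae P, forall w, forall m y, slice (S `\` atoms P Y) idx m y -> Y w != y}.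
  have inj' : {in S `\` atoms P Y &, injective idx}.
    by move=> x y; rewrite !inE => -[Sx _] [Sy _]; apply: idx_inj; rewrite inE.
  apply: ae_foralln => m; have [->|[y sy]] := slice_cases inj' m.
    by apply: aeW => w y.
  have [[Sy nay] _] : slice (S `\` atoms P Y) idx m y by rewrite sy.
  exists (Y @^-1` [set y]); split => //.
    by apply/eqP; rewrite eq_le measure_ge0 andbT leNgt; apply/negP.
  move=> w /= nw; apply: contrapT => Yw; apply: nw => z; rewrite sy => -> /=.
  by apply/eqP.
move: YS; apply: filterS2 => w Sw nw; apply: contrapT => naw.
have : slice (S `\` atoms P Y) idx (idx (Y w)) (Y w) by split.
by move/nw; rewrite eqxx.
Qed.

End discrete_atoms.

(** * The ratio formula for the filtered arcade martingale *)

Local Close Scope ereal_scope.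

Section bayes_mean_rewriting.
Context {R : realType}.
Lemma bayes_mean_eq (mu : {measure set (measurableTypeR R) -> \bar R})
    (q a b : R -> R) (m : R) :
  (forall y, y * q y = a y) -> (forall y, q y = b y) ->
  [/\ mu.-integrable setT (fun y => (y * q y)%:E),
      mu.-integrable setT (fun y => (q y)%:E),
      0 < \int[mu]_y q y & m = (\int[mu]_y (y * q y)) / (\int[mu]_y q y)] ->
  [/\ mu.-integrable setT (fun y => (a y)%:E),
      mu.-integrable setT (fun y => (b y)%:E),
      0 < \int[mu]_y b y & m = (\int[mu]_y a y) / (\int[mu]_y b y)].
Proof.
move=> qa /funext <-.
by have <- : (fun y => y * q y) = a by exact/funext.
Qed.

Lemma eq_rsum (D : set R) (a b : R -> R) :
  (forall y, D y -> a y = b y) -> rsum D a = rsum D b.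
Proof.
by move=> ab; congr (fine _ - fine _); apply: eq_esum => y Dy; rewrite ab.
Qed.

Lemma eq_summable (D : set R) (a b : R -> R) :
  (forall y, D y -> a y = b y) -> summable D (EFin \o a) -> summable D (EFin \o b).
Proof.
move=> ab; rewrite /summable; congr (_ < _)%E.
by apply: eq_esum => y Dy; rewrite /= ab.
Qed.

End bayes_mean_rewriting.

Theorem proposition5p19 (d : measure_display) (Omega : measurableType d)
    (R : realType) (P : probability Omega R)
    (n : nat) (T : 'I_n.+1 -> R)
    (D : R -> {RV P >-> R}) (X : 'I_n.+1 -> {RV P >-> R})
    (f g : 'I_n.+1 -> R -> R) (M : R -> Omega -> R) (t : R) :
  (1 <= n)%N -> dates T ->
  driver T P D -> marginal_densities T P D ->
  martingale_coupling P X -> independent_of_driver T P X D ->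
  interpolating T f -> interpolating T g ->
  let I := rap T D X f g in
  conditionally_markov T P I -> is_FAM T P X I M ->
  open_arcs T t ->
  let Xm := past T X t in
  let Xn : Omega -> R := X ord_max in
  (joint_densities T P D ->
     exists h, is_cond_density P (fun w => (Xm w, Xn w)) (I t) h) /\
  forall h, is_cond_density P (fun w => (Xm w, Xn w)) (I t) h ->
  [/\ forall F, is_cond_cdf P Xm Xn F ->
        {ae P, forall w, let dF := lebesgue_stieltjes_measure (F (Xm w)) in
          [/\ dF.-integrable setT (fun y => (y * h (Xm w, y) (I t w))%:E),
              dF.-integrable setT (fun y => (h (Xm w, y) (I t w))%:E),
              0 < \int[dF]_y (h (Xm w, y) (I t w)) &
              M t w = (\int[dF]_y (y * h (Xm w, y) (I t w)))
                      / (\int[dF]_y (h (Xm w, y) (I t w)))]},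
      has_density P (fun w => [tuple of rcons (Xm w) (Xn w)]) ->
      forall p, is_cond_density P Xm Xn p ->
        {ae P, forall w, let dy := lebesgue_measure in
          [/\ dy.-integrable setT
                (fun y => (y * h (Xm w, y) (I t w) * p (Xm w) y)%:E),
              dy.-integrable setT
                (fun y => (h (Xm w, y) (I t w) * p (Xm w) y)%:E),
              0 < \int[dy]_y (h (Xm w, y) (I t w) * p (Xm w) y) &
              M t w = (\int[dy]_y (y * h (Xm w, y) (I t w) * p (Xm w) y))
                      / (\int[dy]_y (h (Xm w, y) (I t w) * p (Xm w) y))]}
    & is_discrete P (fun w => [tuple of rcons (Xm w) (Xn w)]) ->
      forall q : R -> Omega -> R,
        (forall y, is_cond_prob P (sigma_of Xm) (Xn @^-1` [set y]) (q y)) ->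
        {ae P, forall w, let S := atoms P Xn in
          [/\ summable S (fun y => (y * h (Xm w, y) (I t w) * q y w)%:E),
              summable S (fun y => (h (Xm w, y) (I t w) * q y w)%:E),
              0 < rsum S (fun y => h (Xm w, y) (I t w) * q y w) &
              M t w = rsum S (fun y => y * h (Xm w, y) (I t w) * q y w)
                      / rsum S (fun y => h (Xm w, y) (I t w) * q y w)]}].
Proof.
move=> _ hT _ _ hX XD hf hg I hMk hM ht Xm Xn.
have hh := horizon_open_arcs hT ht.
split; first by move=> hD; exact: rap_cond_density.
move=> h hI.
have mXm : measurable_fun setT Xm by exact: measurable_past.
have mXn : measurable_fun setT Xn by [].
have mI : measurable_fun setT (I t) by exact: measurable_rap.
have mk := rap_markov hT hh hf hg hMk.
have iX : P.-integrable setT (EFin \o Xn) by exact: hX.1.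
have sG : sigma_algebra setT (history T I t) by exact: sigma_algebra_history.
have Gm : history T I t `<=` measurable by exact: history_sub_measurable.
have VG : sigma_of (fun w => (Xm w, I t w)) `<=` history T I t.
  exact: sigma_past_sub_history.
have bm k rho mrho rho0 HY :=
  bayes_mean_given mXm mXn mI hI (k := k) (rho := rho) mrho rho0 HY sG Gm VG mk iX (hM _ hh).
split.
- move=> F hF.
  have m1 : measurable_fun setT (cst 1 :
      g_sigma_algebra_preimageType Xm * measurableTypeR R -> R).
    exact: measurable_cst.
  have HY A B : sigma_of Xm A -> measurable B -> P (A `&` Xn @^-1` B) =
      (\int[P]_(w in A) \int[kcdf (measurable_cond_cdf hF) w]_(y in B)
        (cst 1 (w, y))%:E)%E.
    move=> sA mB; rewrite (cond_cdf_disintegrates mXm mXn hF sA mB).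
    apply: eq_integral => w _.
    by rewrite (eq_integral (cst 1%E))// integral_cst// mul1e.
  have := bm _ _ m1 (fun=> ler01) HY; apply: filterS => w.
  move=> H.
  apply: (bayes_mean_eq (mu := lebesgue_stieltjes_measure (F (Xm w))) _ _ H).
    by move=> y; rewrite mulr1.
  by move=> y; rewrite mulr1.
- move=> _ p hp.
  have [mp p0 _] := hp.
  pose rho (x : g_sigma_algebra_preimageType Xm * measurableTypeR R) := p (Xm x.1) x.2.
  have mrho : measurable_fun setT rho.
    apply: (measurableT_comp (f := fun zy : _ * R => p zy.1 zy.2)
      (g := fun x : g_sigma_algebra_preimageType Xm * measurableTypeR R =>
        (Xm x.1, x.2 : R)) mp).
    apply: measurable_fun_pair; last exact: measurable_snd.
    apply: measurableT_comp; last exact: measurable_fst.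
    by move=> _ A mA; exists A.
  pose leb : R.-sfker (g_sigma_algebra_preimageType Xm) ~> measurableTypeR R :=
    kcst (@lebesgue_measure R).
  have rho0 x : 0 <= rho x by exact: p0.
  have HY A B : sigma_of Xm A -> measurable B -> P (A `&` Xn @^-1` B) =
      (\int[P]_(w in A) \int[leb w]_(y in B) (rho (w, y))%:E)%E.
    move=> /sigma_ofP[C mC ->] mB.
    by have := cond_density_disintegrates mXm mXn hp mC mB; rewrite setTI.
  have := bm leb rho mrho rho0 HY; apply: filterS => w H.
  apply: (bayes_mean_eq (mu := lebesgue_measure) _ _ H) => // y.
  by rewrite mulrA.
- move=> [S [cS hS]] q hq.
  have XnS : {ae P, forall w, ((fun v => tnth v ord_max) @` S) (Xn w)}.
    apply: filterS hS => w Sw; exists [tuple of rcons (Xm w) (Xn w)] => //.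
    exact: tnth_rcons_last.
  have cS' : countable ((fun v => tnth v ord_max) @` S).
    exact: sub_countable (card_image_le _ _) cS.
  have [idx [idx_inj atX]] := countable_atoms mXn cS' XnS.
  have HY A B := @cond_mass_disintegrates _ _ _ P _ _ Xm Xn mXm mXn _ _ idx_inj atX q hq A B.
  have := bm _ _ (measurable_mass_weight idx_inj hq) (mass_weight_ge0 _ _) HY.
  have := cond_mass_ae_ge0 mXm idx_inj hq.
  apply: filterS2 => w q0 [i1 i2 D0 ME].
  have [s1 e1] := Rintegral_kcount idx_inj i1.
  have [s2 e2] := Rintegral_kcount idx_inj i2.
  (* On the atoms the truncation in [mass_weight] is almost surely
     invisible. *)
  have wE y : atoms P Xn y -> mass_weight (Z := Xm) (atoms P Xn) q (w, y) = q y w.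
    by move=> Dy; rewrite /mass_weight /= mem_set// max_l// q0.
  have aE y : atoms P Xn y ->
      y * (h (Xm w, y) (I t w) *
        mass_weight (Z := Xm) (atoms P Xn) q (w, y)) =
      y * h (Xm w, y) (I t w) * q y w.
    by move=> Dy; rewrite wE// mulrA.
  have bE y : atoms P Xn y -> h (Xm w, y) (I t w) *
        mass_weight (Z := Xm) (atoms P Xn) q (w, y) =
      h (Xm w, y) (I t w) * q y w.
    by move=> Dy; rewrite wE.
  split.
  - exact: (eq_summable aE s1).
  - exact: (eq_summable bE s2).
  - by rewrite -(eq_rsum bE) -e2.
  - by rewrite ME -(eq_rsum aE) -(eq_rsum bE) -e1 -e2.
Qed.
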